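(* Let $\alpha=\frac12$, $\mu>0$, $s>1$, $\theta_0\in H^s$, and let $\theta\in L^\infty([0,T];H^s)$ be the solution of the regularized QG initial value problem given by local existence. Let $T_1>T$. If $\sup\{\|\theta(\cdot,t)\|_1: t<T_1,\ \theta \text{ defined at } t\}<\infty$ (i.e. $\theta\in L^\infty([0,T_1];H^1)$ on its interval of existence), then $\theta$ can be extended to a solution in $L^\infty([0,T_1];H^s)$.
   Context: Setting: $\Omega=[0,2\pi]^2$ with periodic boundary conditions; all functions are periodic with zero mean. For a periodic distribution $f$, $\hat f(k)=(2\pi)^{-2}\int_\Omega f(x)e^{-ik\cdot x}\,dx$, $k\in\mathbb Z^2$. $\Lambda=(-\Delta)^{1/2}$, $\widehat{\Lambda^\beta f}(k)=|k|^\beta\hat f(k)$. Riesz transforms: $\widehat{\mathcal R_j f}(k)=-i\frac{k_j}{|k|}\hat f(k)$, $k\ne0$. $\|f\|_s=(\sum_k|k|^{2s}|\hat f(k)|^2)^{1/2}$, $H^s=\{f:\|f\|_s<\infty\}$. The regularized QG initial value problem (with zero forcing) is $$\theta_t+u\cdot\nabla\theta+\mu(-\Delta)^\alpha\theta_t=0,\quad u=(-\mathcal R_2\theta,\mathcal R_1\theta),\quad\theta(x,0)=\theta_0(x),$$ with $\mu>0$. A solution on $[0,T]$ in $L^\infty([0,T];H^s)$ means $\theta\in L^\infty([0,T];H^s)$ satisfying $\theta(t)=\theta_0-\int_0^t(1+\mu\Lambda^{2\alpha})^{-1}\nabla\cdot(u\theta)(\tau)\,d\tau$. For $\alpha\ge\frac12$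 and $s>1$ such a solution exists and is unique on a short time interval. *)

(* Defs.v *)
(* mathcomp-analysis over an arbitrary R : realType,
   complex numbers R[i] from mathcomp-real-closed.
   Periodic zero-mean functions on [0,2pi]^2 are represented by their
   Fourier coefficients  f : int * int -> R[i]  (f k = \hat f(k)). *)
From HB Require Import structures.
From mathcomp Require Import all_boot all_order all_algebra.
From mathcomp Require Import all_classical all_reals all_analysis.
From mathcomp Require Import complex.
Set Implicit Arguments. Unset Strict Implicit. Unset Printing Implicit Defensive.
Import Order.TTheory GRing.Theory Num.Theory.
Import numFieldNormedType.Exports.
Local Open Scope ring_scope.
Local Open Scope classical_set_scope.

Definition Z2 := (int * int)%type.

Section QG.
Variable R : realType.
Local Notation C := (complex R).

Definition cre (z : C) : R := complex.Re z.
Definition cim (z : C) : R := complex.Im z.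
Definition cabs2 (z : C) : R := cre z ^+ 2 + cim z ^+ 2.
Definition cI : C := Complex 0 1.
Definition cR (x : R) : C := Complex x 0.

Definition k1 (k : Z2) : R := k.1%:~R.
Definition k2 (k : Z2) : R := k.2%:~R.
Definition knorm (k : Z2) : R := Num.sqrt (k1 k ^+ 2 + k2 k ^+ 2).

Definition sq_sum (N : nat) (F : Z2 -> C) : C :=
  \sum_(i < (2 * N).+1) \sum_(j < (2 * N).+1)
     F ((i%:Z - N%:Z)%R, (j%:Z - N%:Z)%R).
Definition sq_sumR (N : nat) (F : Z2 -> R) : R :=
  \sum_(i < (2 * N).+1) \sum_(j < (2 * N).+1)
     F ((i%:Z - N%:Z)%R, (j%:Z - N%:Z)%R).

(* sum over Z^2 (as the limit of square partial sums; used only for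
   absolutely summable families, for which it is the usual sum) *)
Definition zsum (F : Z2 -> C) : C :=
  Complex (limn (fun N => cre (sq_sum N F))) (limn (fun N => cim (sq_sum N F))).

Definition Hs_norm2 (s : R) (f : Z2 -> C) : \bar R :=
  ereal_sup (range (fun N : nat =>
    (sq_sumR N (fun k => knorm k `^ (2 * s) * cabs2 (f k)))%:E)).

(* f is (the Fourier transform of) a real-valued, zero-mean, periodic
   function in H^s *)
Definition in_Hs (s : R) (f : Z2 -> C) : Prop :=
  [/\ f (0, 0) = 0,
      (forall k : Z2, f (- k.1, - k.2)%R = Complex (cre (f k)) (- cim (f k))) &
      (Hs_norm2 s f < +oo)%E].

Definition riesz1 (f : Z2 -> C) (k : Z2) : C :=
  if k == (0, 0) then 0 else - cI * cR (k1 k / knorm k) * f k.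
Definition riesz2 (f : Z2 -> C) (k : Z2) : C :=
  if k == (0, 0) then 0 else - cI * cR (k2 k / knorm k) * f k.

Definition vel1 (f : Z2 -> C) : Z2 -> C := fun k => - riesz2 f k.
Definition vel2 (f : Z2 -> C) : Z2 -> C := fun k => riesz1 f k.

Definition conv (f g : Z2 -> C) (k : Z2) : C :=
  zsum (fun j => f j * g (k.1 - j.1, k.2 - j.2)%R).

Definition div_hat (v1 v2 : Z2 -> C) (k : Z2) : C :=
  cI * (cR (k1 k) * v1 k + cR (k2 k) * v2 k).

(* Fourier coefficients of (1 + mu Lambda^{2 alpha})^{-1} div (u theta) *)
Definition qg_rhs (alpha mu : R) (f : Z2 -> C) (k : Z2) : C :=
  cR (1 + mu * knorm k `^ (2 * alpha))^-1 *
  div_hat (conv (vel1 f) f) (conv (vel2 f) f) k.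

(* theta is a solution on [0,T] in L^infty([0,T]; H^s) of the regularized
   QG problem (zero forcing) with initial datum th0, i.e.
   theta(t) = th0 - int_0^t (1+mu Lambda^{2alpha})^{-1} div(u theta) dtau,
   written coefficientwise in Fourier variables. *)
Definition qg_solution (alpha mu s T : R) (th0 : Z2 -> C) (th : R -> Z2 -> C)
  : Prop :=
  [/\ forall t, 0 <= t <= T -> in_Hs s (th t),
      exists M : R, forall t, 0 <= t <= T -> (Hs_norm2 s (th t) <= M%:E)%E,
      forall k : Z2, measurable_fun `[0, T] (fun t => cre (th t k)) /\
                     measurable_fun `[0, T] (fun t => cim (th t k)) &
      forall t, 0 <= t <= T -> forall k : Z2,
        [/\ (@lebesgue_measure R).-integrable `[0, t]
               (EFin \o (fun tau => cre (qg_rhs alpha mu (th tau) k))),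
            (@lebesgue_measure R).-integrable `[0, t]
               (EFin \o (fun tau => cim (qg_rhs alpha mu (th tau) k))) &
            th t k = th0 k -
              Complex
                (Rintegral (@lebesgue_measure R) `[0, t]
                   (fun tau => cre (qg_rhs alpha mu (th tau) k)))
                (Rintegral (@lebesgue_measure R) `[0, t]
                   (fun tau => cim (qg_rhs alpha mu (th tau) k)))]].

End QG.

(* Main.v *)
(* For alpha = 1/2 the operator (1 + mu Lambda)^-1 div has order 0, so the equation is an
   ODE theta' = - B(theta, theta) with B bounded and bilinear on H^s, s > 1.  Writing |.|_1
   for the l^1 norm of the Fourier coefficients, B obeys the tame estimate
   ||B(f,f)||_s <= C |f|_1 ||f||_s.  Picard iteration extends a solution by a time depending
   only on its H^s norm, so it suffices to bound that norm a priori on [0, T1).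
   Splitting the frequencies at 2^m gives |f|_1 <= C (sqrt m ||f||_1 + 2^(-m(s-1)) ||f||_s).
   If ||theta||_s <= 2^(m(s-1)) on the whole interval and ||theta||_1 <= M, the Gronwall rate
   is C (sqrt m M + 1), whence ||theta||_s <= exp(C T1 (sqrt m M + 1)) ||theta_0||_s, which is
   below 2^((m-1)(s-1)) for large m.  Descending on m yields a bound depending only on
   M, T1, s, mu and theta_0. *)
Require Import Defs.
From mathcomp Require Import all_boot all_order all_algebra.
From mathcomp Require Import all_classical all_reals all_analysis.
From mathcomp Require Import complex.
From mathcomp Require Import measurable_realfun ring lra zify.
Import Order.TTheory GRing.Theory Num.Theory.
Import numFieldNormedType.Exports.
Local Open Scope ring_scope.

(** * Finite l2 norms and complex moduli *)

Section FiniteSums.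
Set Implicit Arguments.
Unset Strict Implicit.
Variables (R : realType) (I : eqType).
Implicit Types (S : seq I) (a b : I -> R).

(** In two dimensions H^1 just fails to control the l^1 norm, and the failure is logarithmic.
    Splitting at 2^m costs only sqrt m, so the Gronwall factor is exponential in sqrt m, whereas the
    threshold being improved is exponential in m; this gap closes the descent. A solution carries by
    definition some finite H^s bound of unknown size. The descent starts from that bound but stops
    at an index independent of it, so it replaces a continuity argument in time. Gronwall's
    inequality is discrete: the equation is known coefficient by coefficient, so instead of
    differentiating the norm one bounds it over short steps on which it at most doubles. Norm bounds
    range over all finite duplicate-free lists of frequencies. In this form they are stable under
    translation, reindexing and coefficientwise limits, and infinite sums enter only as limits of
    finite ones. The H^1 hypothesis speaks of every solution on an interval ending before T_1, so it
    applies to each extension as it is built. *)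

Lemma ler_sum_subset S S' a : uniq S -> {subset S <= S'} ->
  (forall i, 0 <= a i) -> \sum_(i <- S) a i <= \sum_(i <- S') a i.
Proof.
move=> uS sub a0; elim: S uS S' sub => [|x S IH] /=.
  by move=> _ S' _; rewrite big_nil sumr_ge0.
move=> /andP[xS uS] S' sub; rewrite big_cons.
have xS' : x \in S' by apply: sub; rewrite inE eqxx.
rewrite (perm_big _ (perm_to_rem xS')) big_cons lerD2l; apply: IH => // y yS.
have : y \in S' by apply: sub; rewrite inE yS orbT.
rewrite (perm_mem (perm_to_rem xS')) inE => /orP[/eqP yx|//].
by rewrite -yx yS in xS.
Qed.

Definition l2norm S a : R := Num.sqrt (\sum_(i <- S) a i ^+ 2).

Lemma l2norm_ge0 S a : 0 <= l2norm S a.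
Proof. exact: sqrtr_ge0. Qed.

Lemma sqr_l2norm S a : l2norm S a ^+ 2 = \sum_(i <- S) a i ^+ 2.
Proof. by rewrite sqr_sqrtr // sumr_ge0 // => i _; rewrite sqr_ge0. Qed.

Lemma l2norm_leP S a A : 0 <= A ->
  (l2norm S a <= A) = (\sum_(i <- S) a i ^+ 2 <= A ^+ 2).
Proof. by move=> A0; rewrite -sqr_l2norm ler_sqr // nnegrE l2norm_ge0. Qed.

Lemma cauchy_schwarz_sum S a b :
  \sum_(i <- S) a i * b i <= l2norm S a * l2norm S b.
Proof.
rewrite /l2norm -sqrtrM ?sumr_ge0 // => [|i _]; last exact: sqr_ge0.
apply: le_trans (ler_norm _) _; rewrite -sqrtr_sqr ler_wsqrtr //.
elim: S => [|x S IH]; first by rewrite !big_nil mulr0 expr0n.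
rewrite !big_cons.
set X := \sum_(i <- S) a i * b i in IH *.
set A := \sum_(i <- S) a i ^+ 2 in IH *; set B := \sum_(i <- S) b i ^+ 2 in IH *.
have A0 : 0 <= A by apply: sumr_ge0 => i _; exact: sqr_ge0.
have B0 : 0 <= B by apply: sumr_ge0 => i _; exact: sqr_ge0.
(* Since [X ^+ 2 <= A * B] by induction, this is the arithmetic-geometric inequality for
   [A * b x ^+ 2] and [a x ^+ 2 * B]. *)
suff: 2 * (a x * b x) * X <= A * b x ^+ 2 + a x ^+ 2 * B by nra.
apply: le_trans (ler_norm _) _; rewrite -ler_sqr ?nnegrE ?normr_ge0 //; last first.
  by rewrite addr_ge0 // mulr_ge0 // sqr_ge0.
rewrite real_normK ?num_real //.
apply: (@le_trans _ _ (4 * (A * b x ^+ 2) * (a x ^+ 2 * B))).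
  rewrite [leLHS](_ : _ = 4 * (a x * b x) ^+ 2 * X ^+ 2); last by ring.
  rewrite [leRHS](_ : _ = 4 * (a x * b x) ^+ 2 * (A * B)); last by ring.
  by rewrite ler_wpM2l // mulr_ge0 // sqr_ge0.
rewrite -subr_ge0 (_ : _ - _ = (A * b x ^+ 2 - a x ^+ 2 * B) ^+ 2); last by ring.
exact: sqr_ge0.
Qed.

Lemma l2normD S a b : l2norm S (fun i => a i + b i) <= l2norm S a + l2norm S b.
Proof.
rewrite l2norm_leP ?addr_ge0 ?l2norm_ge0 // sqrrD !sqr_l2norm.
under eq_bigr do rewrite sqrrD.
rewrite !big_split /= lerD2r lerD2l -mulr2n lerMn2r /=.
exact: cauchy_schwarz_sum.
Qed.

Lemma ler_l2norm S a b : (forall i, i \in S -> 0 <= a i <= b i) ->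
  l2norm S a <= l2norm S b.
Proof.
move=> ab; apply: ler_wsqrtr; rewrite big_seq [leRHS]big_seq.
apply: ler_sum => i /ab /andP[a0 aleb]; rewrite ler_sqr // nnegrE //.
exact: le_trans aleb.
Qed.

Lemma l2normZ S c a : 0 <= c -> l2norm S (fun i => c * a i) = c * l2norm S a.
Proof.
move=> c0; rewrite /l2norm; under eq_bigr do rewrite exprMn.
by rewrite -mulr_sumr sqrtrM ?sqr_ge0 // sqrtr_sqr ger0_norm.
Qed.

Lemma l2norm_sum (J : Type) (r : seq J) S (F : J -> I -> R) :
  l2norm S (fun i => \sum_(j <- r) F j i) <= \sum_(j <- r) l2norm S (F j).
Proof.
elim: r => [|j r IH].
  rewrite big_nil /l2norm big1 ?sqrtr0 // => i _.
  by rewrite big_nil expr0n.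
rewrite big_cons (_ : l2norm _ _ = l2norm S (fun i => F j i + \sum_(l <- r) F l i)).
  by apply: le_trans (l2normD _ _ _) _; rewrite lerD2l.
by congr Num.sqrt; apply: eq_bigr => i _; rewrite big_cons.
Qed.

Lemma l2norm_map (J : eqType) (f : J -> I) (S : seq J) a :
  l2norm (map f S) a = Num.sqrt (\sum_(j <- S) a (f j) ^+ 2).
Proof. by rewrite /l2norm big_map. Qed.

End FiniteSums.

Section Modulus.
Set Implicit Arguments.
Unset Strict Implicit.
Variable R : realType.
Implicit Types z w : R[i].

Definition cmod z : R := Num.sqrt (cabs2 z).

Lemma cabs2_ge0 z : 0 <= cabs2 z.
Proof. by rewrite /cabs2 addr_ge0 // sqr_ge0. Qed.

Lemma cmod_ge0 z : 0 <= cmod z. Proof. exact: sqrtr_ge0. Qed.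

Lemma sqr_cmod z : cmod z ^+ 2 = cabs2 z.
Proof. by rewrite sqr_sqrtr // cabs2_ge0. Qed.

Lemma creD z w : cre (z + w) = cre z + cre w.
Proof. by case: z; case: w. Qed.
Lemma cimD z w : cim (z + w) = cim z + cim w.
Proof. by case: z; case: w. Qed.
Lemma creN z : cre (- z) = - cre z. Proof. by case: z. Qed.
Lemma cimN z : cim (- z) = - cim z. Proof. by case: z. Qed.
Lemma creM z w : cre (z * w) = cre z * cre w - cim z * cim w.
Proof. by case: z; case: w. Qed.
Lemma cimM z w : cim (z * w) = cre z * cim w + cim z * cre w.
Proof. by case: z; case: w. Qed.

Lemma cre_sum (J : Type) (r : seq J) (P : pred J) (F : J -> R[i]) :
  cre (\sum_(j <- r | P j) F j) = \sum_(j <- r | P j) cre (F j).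
Proof. by apply: (big_morph _ creD). Qed.
Lemma cim_sum (J : Type) (r : seq J) (P : pred J) (F : J -> R[i]) :
  cim (\sum_(j <- r | P j) F j) = \sum_(j <- r | P j) cim (F j).
Proof. by apply: (big_morph _ cimD). Qed.

Lemma complexP z w : cre z = cre w -> cim z = cim w -> z = w.
Proof. by case: z => a b; case: w => c d /= -> ->. Qed.

Lemma cmodM z w : cmod (z * w) = cmod z * cmod w.
Proof.
rewrite /cmod -sqrtrM ?cabs2_ge0 //; congr Num.sqrt.
by rewrite /cabs2 creM cimM; ring.
Qed.

Lemma cmodN z : cmod (- z) = cmod z.
Proof. by rewrite /cmod /cabs2 creN cimN !sqrrN. Qed.

Lemma cmod0 : cmod 0 = 0.
Proof. by rewrite /cmod /cabs2 /= expr0n addr0 sqrtr0. Qed.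

Lemma cmod_cR (x : R) : cmod (cR x) = `|x|.
Proof. by rewrite /cmod /cabs2 /= expr0n addr0 sqrtr_sqr. Qed.

Lemma cmod_cI : cmod (cI R) = 1.
Proof. by rewrite /cmod /cabs2 /= expr0n expr1n add0r sqrtr1. Qed.

Lemma dot_le_cmod z w : cre z * cre w + cim z * cim w <= cmod z * cmod w.
Proof.
rewrite /cmod -sqrtrM ?cabs2_ge0 //; apply: le_trans (ler_norm _) _.
rewrite -sqrtr_sqr ler_wsqrtr // /cabs2 -subr_ge0.
rewrite (_ : _ - _ = (cre z * cim w - cim z * cre w) ^+ 2) ?sqr_ge0 //; ring.
Qed.

Lemma cmodD z w : cmod (z + w) <= cmod z + cmod w.
Proof.
rewrite -ler_sqr ?nnegrE ?addr_ge0 ?cmod_ge0 // sqrrD !sqr_cmod.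
rewrite /cabs2 creD cimD; have := dot_le_cmod z w; lra.
Qed.

Lemma cmodB z w : cmod (z - w) <= cmod z + cmod w.
Proof. by rewrite -(cmodN w) cmodD. Qed.

Lemma cre_le_cmod z : `|cre z| <= cmod z.
Proof. by rewrite -sqrtr_sqr ler_wsqrtr // lerDl sqr_ge0. Qed.
Lemma cim_le_cmod z : `|cim z| <= cmod z.
Proof. by rewrite -sqrtr_sqr ler_wsqrtr // lerDr sqr_ge0. Qed.

Definition cconj z : R[i] := Complex (cre z) (- cim z).

Lemma cconjM z w : cconj (z * w) = cconj z * cconj w.
Proof.
by case: z => a b; case: w => c d; apply: complexP => /=; ring.
Qed.
Lemma cconjD z w : cconj (z + w) = cconj z + cconj w.
Proof. by apply: complexP; rewrite /cconj /= ?creD ?cimD /= ?opprD. Qed.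
Lemma cconjN z : cconj (- z) = - cconj z.
Proof. by apply: complexP; rewrite /cconj /= ?creN ?cimN /=. Qed.
Lemma cconj_cR (x : R) : cconj (cR x) = cR x.
Proof. by apply: complexP => //=; rewrite oppr0. Qed.
Lemma cconj_cI : cconj (cI R) = - cI R.
Proof. by apply: complexP => //=; rewrite oppr0. Qed.

End Modulus.

(** * The lattice of frequencies *)

Section Lattice.
Set Implicit Arguments.
Unset Strict Implicit.
Local Open Scope classical_set_scope.
Variable R : realType.
Implicit Types (k : Z2) (S : seq Z2).

Definition subZ k j : Z2 := (k.1 - j.1, k.2 - j.2).
Definition negZ k : Z2 := (- k.1, - k.2).

Lemma subZK k j : subZ k (subZ k j) = j.
Proof. by case: k => a b; case: j => c d; rewrite /subZ /= !subKr. Qed.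

Lemma subZ_injl k : injective (subZ k).
Proof. exact: can_inj (subZK k). Qed.

Lemma subZ_injr j : injective (subZ^~ j).
Proof. by case: j => c d [a b] [a' b'] [/addIr -> /addIr ->]. Qed.

Lemma negZK : involutive negZ.
Proof. by case=> a b; rewrite /negZ /= !opprK. Qed.

Lemma knorm_ge0 k : 0 <= knorm R k. Proof. exact: sqrtr_ge0. Qed.

Lemma knormN k : knorm R (negZ k) = knorm R k.
Proof. by rewrite /knorm /k1 /k2 /= !rmorphN !sqrrN. Qed.

Lemma knorm_sub k j : knorm R k <= knorm R j + knorm R (subZ k j).
Proof.
have E l : knorm R l = cmod (Complex (k1 R l) (k2 R l)) by [].
rewrite !E; apply: le_trans (cmodD _ _); rewrite le_eqVlt; apply/orP; left.
apply/eqP; congr cmod; apply: complexP => /=; rewrite /k1 /k2 /= rmorphB /= /cre /cim /=;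
by rewrite addrC subrK.
Qed.

Lemma abs_k1_le k : `|k1 R k| <= knorm R k.
Proof. by rewrite -sqrtr_sqr ler_wsqrtr // lerDl sqr_ge0. Qed.
Lemma abs_k2_le k : `|k2 R k| <= knorm R k.
Proof. by rewrite -sqrtr_sqr ler_wsqrtr // lerDr sqr_ge0. Qed.

(** Natural-number size of a frequency: its balls are the squares of [sq_sum], and its truncated
    logarithm indexes the dyadic shells. *)
Definition supnorm k : nat := maxn `|k.1|%N `|k.2|%N.

Lemma supnorm_le_knorm k : (supnorm k)%:R <= knorm R k.
Proof.
rewrite /supnorm; case: leqP => _.
  by rewrite (le_trans _ (abs_k2_le k)) // /k2 natr_absz intr_norm.
by rewrite (le_trans _ (abs_k1_le k)) // /k1 natr_absz intr_norm.
Qed.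

Lemma supnorm_eq0 k : (supnorm k == 0%N) = (k == (0, 0)).
Proof.
case: k => a b; rewrite /supnorm /= -leqn0 geq_max !leqn0 !absz_eq0.
by rewrite xpair_eqE.
Qed.

Lemma knorm_ge1 k : k != (0, 0) -> 1 <= knorm R k.
Proof.
rewrite -supnorm_eq0 -lt0n => k0; apply: le_trans (supnorm_le_knorm k).
by rewrite ler1n.
Qed.

Definition square (N : nat) : seq Z2 :=
  [seq ((i%:Z - N%:Z)%R, (j%:Z - N%:Z)%R) | i : nat <- index_iota 0 (2 * N).+1,
                                            j : nat <- index_iota 0 (2 * N).+1].

Lemma sq_sumE N (F : Z2 -> R[i]) : sq_sum N F = \sum_(k <- square N) F k.
Proof.
rewrite /sq_sum /square big_allpairs_dep big_mkord; apply: eq_bigr => i _.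
by rewrite big_mkord.
Qed.

Lemma sq_sumRE N (F : Z2 -> R) : sq_sumR N F = \sum_(k <- square N) F k.
Proof.
rewrite /sq_sumR /square big_allpairs_dep big_mkord; apply: eq_bigr => i _.
by rewrite big_mkord.
Qed.

Lemma square_uniq N : uniq (square N).
Proof.
apply: allpairs_uniq; rewrite ?iota_uniq // => -[a b] [c d] _ _ /= [].
by move=> /addIr [->] /addIr [->].
Qed.

Lemma mem_square N k : (k \in square N) = (supnorm k <= N)%N.
Proof.
case: k => a b; rewrite /supnorm /= geq_max; apply/allpairsP/andP.
  move=> [[i j] /= []]; rewrite !mem_index_iota => Hi Hj [-> ->]; lia.
move=> [Ha Hb]; exists (absz (a + N%:Z), absz (b + N%:Z)).
by rewrite /= !mem_index_iota; split; [lia|lia|congr pair; lia].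
Qed.

Lemma size_square N : size (square N) = ((2 * N).+1 ^ 2)%N.
Proof. by rewrite size_allpairs !size_iota mulnn. Qed.

Lemma square_subset N N' : (N <= N')%N -> {subset square N <= square N'}.
Proof. by move=> NN' k; rewrite !mem_square => /leq_trans; apply. Qed.

Lemma sub_square S : exists N, {subset S <= square N}.
Proof.
exists (\max_(k <- S) supnorm k)%N => k kS; rewrite mem_square.
by rewrite (big_rem k) //= leq_maxl.
Qed.

(** Symmetry of the truncation, used to show that a convolution of real fields is real. *)
Lemma perm_square_neg N : perm_eq (square N) (map negZ (square N)).
Proof.
apply: uniq_perm; rewrite ?square_uniq ?map_inj_uniq ?square_uniq //.
  exact: can_inj negZK.
move=> k; rewrite -{2}(negZK k) mem_map; last exact: can_inj negZK.
by rewrite !mem_square /supnorm /= !abszN.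
Qed.

(** For nonnegative [a] this is summability with total at most [A]. No enumeration is fixed, so the
    bound survives injective reindexing. *)
Definition bounded_sums (a : Z2 -> R) (A : R) :=
  forall S, uniq S -> \sum_(k <- S) a k <= A.

Lemma cvg_nneg_square_sum a A : (forall k, 0 <= a k) -> bounded_sums a A ->
  cvgn (fun N => \sum_(k <- square N) a k).
Proof.
move=> a0 aA; apply: nondecreasing_is_cvgn.
  move=> n m nm; apply: ler_sum_subset => //; first exact: square_uniq.
  exact: square_subset.
by exists A => _ [n _ <-]; apply: aA; exact: square_uniq.
Qed.

(** Write [a] as the difference of the nonnegative families [|a| + a] and [|a|], whose square sums
    are monotone and bounded. *)
Lemma cvg_abs_square_sum (a : Z2 -> R) A : bounded_sums (fun k => `|a k|) A ->
  cvgn (fun N => \sum_(k <- square N) a k).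
Proof.
move=> aA.
have cp : cvgn (fun N => \sum_(k <- square N) (`|a k| + a k)).
  apply: (@cvg_nneg_square_sum _ (A + A)) => [k|S uS].
    by rewrite -lerBlDr sub0r -normrN ler_norm.
  rewrite big_split lerD ?aA //; apply: le_trans (aA _ uS).
  by apply: ler_sum => k _; exact: ler_norm.
have cn := cvg_nneg_square_sum (fun k => normr_ge0 _) aA.
rewrite (_ : (fun _ => _) = (fun N => \sum_(k <- square N) (`|a k| + a k) -
   \sum_(k <- square N) `|a k|)); first exact: is_cvgB.
by apply/funext => N; rewrite big_split /= addrAC subrr add0r.
Qed.

(** Convergence by coordinates, the form in which [zsum] takes its limit. *)
Definition ccvg (u : nat -> R[i]) (l : R[i]) :=
  ((fun n => cre (u n)) @ \oo --> cre l) /\ ((fun n => cim (u n)) @ \oo --> cim l).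

Lemma ccvg_unique u l l' : ccvg u l -> ccvg u l' -> l = l'.
Proof.
move=> [u1 u2] [v1 v2]; apply: complexP.
  by rewrite -(cvg_lim _ u1) // -(cvg_lim _ v1).
by rewrite -(cvg_lim _ u2) // -(cvg_lim _ v2).
Qed.

Lemma ccvg_cst l : ccvg (fun=> l) l.
Proof. by split; exact: cvg_cst. Qed.

Lemma ccvgD u v l l' : ccvg u l -> ccvg v l' -> ccvg (fun n => u n + v n) (l + l').
Proof.
move=> [u1 u2] [v1 v2]; split.
  by rewrite creD; under eq_fun do rewrite creD; exact: cvgD.
by rewrite cimD; under eq_fun do rewrite cimD; exact: cvgD.
Qed.

Lemma ccvgN u l : ccvg u l -> ccvg (fun n => - u n) (- l).
Proof.
move=> [u1 u2]; split.
  by rewrite creN; under eq_fun do rewrite creN; exact: cvgN.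
by rewrite cimN; under eq_fun do rewrite cimN; exact: cvgN.
Qed.

Lemma ccvg_cmod u l : ccvg u l -> (fun n => cmod (u n)) @ \oo --> cmod l.
Proof.
move=> [u1 u2]; rewrite /cmod /cabs2.
apply: (@cvg_comp _ _ _ (fun n => cre (u n) ^+ 2 + cim (u n) ^+ 2) Num.sqrt
  _ (nbhs (cre l ^+ 2 + cim l ^+ 2))).
  by apply: cvgD; rewrite expr2; under eq_fun do rewrite expr2; exact: cvgM.
exact: sqrt_continuous.
Qed.

(** As [S] is finite, coefficientwise convergence suffices. Together with [le_cvg] this plays the
    role of Fatou's lemma. *)
Lemma cvg_l2norm S (w : Z2 -> R) (u : nat -> Z2 -> R[i]) (f : Z2 -> R[i]) :
  (forall k, ccvg (u^~ k) (f k)) ->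
  (fun n => l2norm S (fun k => w k * cmod (u n k))) @ \oo -->
  l2norm S (fun k => w k * cmod (f k)).
Proof.
move=> uf.
have cS : (fun n => \sum_(k <- S) (w k * cmod (u n k)) ^+ 2) @ \oo -->
    \sum_(k <- S) (w k * cmod (f k)) ^+ 2.
  elim: S => [|x S IH].
    rewrite (_ : (fun n => _) = cst (0 : R)) ?big_nil; first exact: cvg_cst.
    by apply/funext => n; rewrite big_nil.
  rewrite big_cons; under eq_fun do rewrite big_cons.
  have c : (fun n => w x * cmod (u n x)) @ \oo --> w x * cmod (f x).
    by apply: cvgM; [exact: cvg_cst|exact: ccvg_cmod].
  apply: (@cvgD _ R^o) => //.
  by rewrite expr2; under eq_fun do rewrite expr2; exact: cvgM.
exact: (@cvg_comp _ _ _ _ Num.sqrt _ _ _ cS (@sqrt_continuous R _)).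
Qed.

Lemma le_cvg (u : nat -> R) l A : u @ \oo --> l -> (forall n, u n <= A) -> l <= A.
Proof. by move=> ul uA; apply: (cvgr_to_le ul); apply: nearW. Qed.

(** Makes the [limn] in [zsum] a genuine limit; identities for convolutions then follow from finite
    sums and uniqueness of limits. *)
Lemma ccvg_zsum (F : Z2 -> R[i]) A : bounded_sums (fun k => cmod (F k)) A ->
  ccvg (fun N => \sum_(k <- square N) F k) (zsum F).
Proof.
move=> FA.
have cE N : cre (sq_sum N F) = \sum_(k <- square N) cre (F k).
  by rewrite sq_sumE cre_sum.
have iE N : cim (sq_sum N F) = \sum_(k <- square N) cim (F k).
  by rewrite sq_sumE cim_sum.
rewrite /zsum; split => /=.
  rewrite (eq_fun cE) (eq_fun (fun N => cre_sum (square N) xpredT F)).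
  apply: (@cvg_abs_square_sum (fun k => cre (F k)) A) => S uS.
  by apply: le_trans (FA _ uS); apply: ler_sum => k _; exact: cre_le_cmod.
rewrite (eq_fun iE) (eq_fun (fun N => cim_sum (square N) xpredT F)).
apply: (@cvg_abs_square_sum (fun k => cim (F k)) A) => S uS.
by apply: le_trans (FA _ uS); apply: ler_sum => k _; exact: cim_le_cmod.
Qed.

End Lattice.

(** * Convolution and l1 estimates *)

Section Estimates.
Set Implicit Arguments.
Unset Strict Implicit.
Local Open Scope classical_set_scope.
Variable R : realType.
Implicit Types (k : Z2) (S J : seq Z2) (a b c : Z2 -> R).

(** The convolution is a superposition of translates of [b] with weights [a j]. Translation is
    injective, so every translate obeys the bound [B], and the triangle inequality sums the
    weights. *)
Lemma young_conv a b S J L B : (forall k, 0 <= a k) -> 0 <= B ->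
  uniq S -> uniq J -> bounded_sums a L ->
  (forall S', uniq S' -> l2norm S' b <= B) ->
  l2norm S (fun k => \sum_(j <- J) a j * b (subZ k j)) <= L * B.
Proof.
move=> a0 B0 uS uJ aL bB; apply: le_trans (l2norm_sum _ _ _) _.
apply: (@le_trans _ _ (\sum_(j <- J) a j * B)); last first.
  by rewrite -mulr_suml ler_wpM2r // aL.
apply: ler_sum => j _; rewrite l2normZ // ler_wpM2l //.
rewrite (_ : l2norm _ _ = l2norm (map (subZ^~ j) S) b); last first.
  by rewrite l2norm_map.
by apply: bB; rewrite map_inj_uniq //; exact: subZ_injr.
Qed.

(** Substituting [l = k - j] exchanges the two factors, but the range of [l] then depends on [k]; it
    is enlarged to the common list [J'], which is harmless for nonnegative terms. *)
Lemma young_conv_sym a b S J L A : (forall k, 0 <= a k) -> (forall k, 0 <= b k) ->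
  0 <= A -> uniq S -> uniq J -> bounded_sums b L ->
  (forall S', uniq S' -> l2norm S' a <= A) ->
  l2norm S (fun k => \sum_(j <- J) a j * b (subZ k j)) <= L * A.
Proof.
move=> a0 b0 A0 uS uJ bL aA.
pose J' := undup [seq subZ k j | k <- S, j <- J].
apply: le_trans (young_conv b0 A0 uS (undup_uniq _ : uniq J') bL aA).
apply: ler_l2norm => k kS; rewrite sumr_ge0 => [|j _]; last by rewrite mulr_ge0.
rewrite (_ : \sum_(j <- J) _ = \sum_(l <- map (subZ k) J) b l * a (subZ k l)) /=.
  apply: ler_sum_subset => [|l /mapP[j jJ ->]|l]; last by rewrite mulr_ge0.
    by rewrite map_inj_uniq //; exact: subZ_injl.
  by rewrite mem_undup; apply/allpairsP; exists (k, j).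
by rewrite big_map; apply: eq_bigr => j _; rewrite subZK mulrC.
Qed.

(** Quasi-subadditivity places the weight on one factor at a time; the other factor is measured in
    l^1. *)
Lemma tame_conv (w : Z2 -> R) D a b S J A B La Lb :
  (forall k, 0 <= w k) -> 0 <= D ->
  (forall k j, w k <= D * (w j + w (subZ k j))) ->
  (forall k, 0 <= a k) -> (forall k, 0 <= b k) ->
  uniq S -> uniq J ->
  (forall S', uniq S' -> l2norm S' (fun k => w k * a k) <= A) ->
  (forall S', uniq S' -> l2norm S' (fun k => w k * b k) <= B) ->
  bounded_sums a La -> bounded_sums b Lb ->
  l2norm S (fun k => w k * \sum_(j <- J) a j * b (subZ k j)) <=
    D * (Lb * A + La * B).
Proof.
move=> w0 D0 wD a0 b0 uS uJ aA bB aL bL.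
have A0 : 0 <= A by apply: le_trans (aA [::] isT); exact: l2norm_ge0.
have B0 : 0 <= B by apply: le_trans (bB [::] isT); exact: l2norm_ge0.
apply: (@le_trans _ _ (l2norm S (fun k => D *
   (\sum_(j <- J) (w j * a j) * b (subZ k j) +
    \sum_(j <- J) a j * (w (subZ k j) * b (subZ k j)))))).
  apply: ler_l2norm => k _; rewrite mulr_ge0 ?sumr_ge0 // => [|j _]; last first.
    by rewrite mulr_ge0.
  rewrite -big_split /= !mulr_sumr; apply: ler_sum => j _.
  rewrite (_ : D * _ = (D * (w j + w (subZ k j))) * (a j * b (subZ k j))); last by ring.
  by rewrite ler_wpM2r // mulr_ge0.
rewrite l2normZ // ler_wpM2l //; apply: le_trans (l2normD _ _ _) _; apply: lerD.
  by apply: (young_conv_sym (a := fun k => w k * a k)) => // k; rewrite mulr_ge0.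
exact: (young_conv (b := fun k => w k * b k)).
Qed.

Lemma powR_knorm_sub (s : R) k j : 0 < s ->
  knorm R k `^ s <= 2 `^ s * (knorm R j `^ s + knorm R (subZ k j) `^ s).
Proof.
move=> s0; have s0' := ltW s0.
pose M := Num.max (knorm R j) (knorm R (subZ k j)).
have M0 : 0 <= M by rewrite le_max knorm_ge0.
apply: (@le_trans _ _ ((2 * M) `^ s)).
  apply: ge0_ler_powR; rewrite ?nnegrE ?knorm_ge0 ?mulr_ge0 //.
  apply: le_trans (knorm_sub R k j) _.
  by rewrite mulrDl !mul1r lerD // le_max lexx ?orbT.
rewrite powRM // ler_wpM2l ?powR_ge0 // /M maxEle.
by case: ifP => _; rewrite ?lerDl ?lerDr powR_ge0.
Qed.

(** * Dyadic shells and the l^1 norm *)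

Lemma geometric_sum_le (x : R) n : 0 <= x < 1 -> \sum_(i < n) x ^+ i <= (1 - x)^-1.
Proof.
move=> /andP[x0 x1]; rewrite -[leRHS]div1r ler_pdivlMr ?subr_gt0 //.
have -> : (\sum_(i < n) x ^+ i) * (1 - x) = 1 - x ^+ n.
  elim: n => [|n IH]; first by rewrite big_ord0 mul0r expr0 subrr.
  by rewrite big_ord_recr /= mulrDl IH exprS; ring.
by rewrite gerBl exprn_ge0.
Qed.

Lemma shell_sum a (e : R) T i : 0 <= e -> (forall k, 0 <= a k) -> uniq T ->
  (forall k, k \in T -> 2 ^ i <= supnorm k < 2 ^ i.+1)%N ->
  \sum_(k <- T) a k <=
    4 * (2 ^+ i / (2 ^+ i) `^ e) * l2norm T (fun k => knorm R k `^ e * a k).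
Proof.
move=> e0 a0 uT HT.
have p0 : 0 < (2 ^+ i : R) by rewrite exprn_gt0.
have p1 : 0 < ((2 ^+ i) `^ e : R) by rewrite powR_gt0.
have -> : \sum_(k <- T) a k = \sum_(k <- T) 1 * a k.
  by apply: eq_bigr => k _; rewrite mul1r.
apply: le_trans (cauchy_schwarz_sum _ _ _) _.
apply: (@le_trans _ _ (4 * 2 ^+ i * l2norm T a)); last first.
  rewrite !mulrA -[leRHS]mulrA ler_pM2l ?mulr_gt0 //.
  rewrite mulrC ler_pdivlMr // mulrC -l2normZ ?powR_ge0 //.
  apply: ler_l2norm => k /HT /andP[ik _].
  rewrite mulr_ge0 ?powR_ge0 //= ler_wpM2r // ge0_ler_powR ?nnegrE ?(ltW p0) ?knorm_ge0 //.
  apply: le_trans (supnorm_le_knorm R k).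
  by rewrite -natrX ler_nat.
apply: ler_wpM2r; first exact: l2norm_ge0.
rewrite l2norm_leP; last by rewrite mulr_ge0 // ltW.
under eq_bigr do rewrite expr1n.
rewrite big_const_seq count_predT iter_addr_0.
have sT : (size T <= size (square (2 ^ i.+1).-1))%N.
  apply: uniq_leq_size => // k /HT /andP[_]; rewrite mem_square.
  by have := expn_gt0 2 i.+1; lia.
rewrite (_ : (4 * 2 ^+ i) ^+ 2 = ((4 * 2 ^ i) ^ 2)%:R); last first.
  by rewrite natrX natrM natrX.
rewrite ler_nat (leq_trans sT) // size_square leq_sqr expnS.
by have := expn_gt0 2 i; lia.
Qed.

Lemma powR2_lt1 (s : R) : 1 < s -> 2 `^ (1 - s) < 1.
Proof.
move=> s1; rewrite /powR pnatr_eq0 /= -[ltRHS]expR0 ltr_expR.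
by rewrite pmulr_llt0 ?subr_lt0 // ln_gt0 // ltr1n.
Qed.

(* Dyadic shells: each shell [2^i <= |k| < 2^(i+1)] contributes at most [4] times its
   [H^1] norm, so the first [m] shells give [sqrt m] by Cauchy-Schwarz, while the
   [H^s] norm makes the remaining ones a geometric series. *)
Lemma l1_log_bound a (s M A : R) m : 1 < s -> (forall k, 0 <= a k) ->
  a (0, 0) = 0 ->
  (forall S, uniq S -> l2norm S (fun k => knorm R k `^ 1 * a k) <= M) ->
  (forall S, uniq S -> l2norm S (fun k => knorm R k `^ s * a k) <= A) ->
  bounded_sums a (4 * Num.sqrt m%:R * M +
    4 / (1 - 2 `^ (1 - s)) * (2 `^ (1 - s)) ^+ m * A).
Proof.
move=> s1 a0 a00 aM aA S uS.
set q := 2 `^ (1 - s).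
have q0 : 0 < q by rewrite powR_gt0.
have q1 : q < 1 by exact: powR2_lt1.
have M0 : 0 <= M by apply: le_trans (aM [::] isT); exact: l2norm_ge0.
have A0 : 0 <= A by apply: le_trans (aA [::] isT); exact: l2norm_ge0.
pose ix k := trunc_log 2 (supnorm k).
(* All shells met by [S] have index below [n]; summing up to [m + n] leaves room for the cut at
   [m]. *)
pose n := (\max_(k <- S) ix k).+1.
(* The zero mode lies in no shell and is removed explicitly; [a (0, 0) = 0] makes this free. *)
pose T i := [seq k <- S | (k != (0, 0)) && (ix k == i)].
have uT i : uniq (T i) by rewrite filter_uniq.
have subT i : {subset T i <= S} by move=> k; rewrite mem_filter => /andP[].
have HT i k : k \in T i -> (2 ^ i <= supnorm k < 2 ^ i.+1)%N.
  rewrite mem_filter => /andP[/andP[k0 /eqP <-] _].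
  by apply: trunc_log_bounds => //; rewrite lt0n supnorm_eq0.
have sumT (f : Z2 -> R) : f (0, 0) = 0 ->
    \sum_(k <- S) f k = \sum_(i < m + n) \sum_(k <- T i) f k.
  move=> f0; under [RHS]eq_bigr do rewrite big_filter big_mkcond.
  rewrite exchange_big /= big_seq [RHS]big_seq; apply: eq_bigr => k kS.
  have [->|k0] := eqVneq k (0, 0).
    by rewrite f0 big1.
  have ikn : (ix k < m + n)%N.
    by rewrite ltn_addl // ltnS (big_rem k) //= leq_maxl.
  rewrite (bigD1 (Ordinal ikn)) //= eqxx big1 ?addr0 // => i ne.
  by case: eqP => // /eqP E; case/eqP: ne; apply/val_inj => /=; apply/esym/eqP.
rewrite (sumT a a00) big_split_ord /=; apply: lerD.
  pose h (i : nat) := l2norm (T i) (fun k => knorm R k `^ 1 * a k).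
  (* The explicit factor 1 prepares Cauchy-Schwarz over the [m] low shells, the source of
     [sqrt m]. *)
  apply: (@le_trans _ _ (4 * \sum_(i <- index_iota 0 m) 1 * h i)).
    rewrite big_mkord mulr_sumr; apply: ler_sum => i _ /=.
    apply: le_trans (shell_sum (e := 1) _ _ _ (HT i)) _ => //.
    by rewrite powRr1 ?exprn_ge0 // divff ?mulr1 ?mul1r // expf_neq0.
  rewrite -mulrA ler_pM2l //; apply: le_trans (cauchy_schwarz_sum _ _ _) _.
  rewrite {1}/l2norm; under eq_bigr do rewrite expr1n.
  rewrite big_const_seq count_predT iter_addr_0 size_iota subn0.
  rewrite ler_wpM2l ?sqrtr_ge0 // l2norm_leP //.
  apply: le_trans (_ : \sum_(k <- S) (knorm R k `^ 1 * a k) ^+ 2 <= _); last first.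
    by rewrite -l2norm_leP // aM.
  rewrite (sumT (fun k => (knorm R k `^ 1 * a k) ^+ 2)); last first.
    by rewrite a00 mulr0 expr0n.
  rewrite big_split_ord /= big_mkord.
  apply: (@le_trans _ _ (\sum_(i < m) \sum_(k <- T i) (knorm R k `^ 1 * a k) ^+ 2)).
    by apply: ler_sum => i _; rewrite /h sqr_l2norm.
  by rewrite lerDl sumr_ge0 // => i _; rewrite sumr_ge0 // => k _; exact: sqr_ge0.
apply: (@le_trans _ _ (\sum_(i < n) 4 * q ^+ (m + i) * A)).
  apply: ler_sum => i _ /=.
  apply: le_trans (shell_sum (e := s) _ _ _ (HT (m + i)%N)) _ => //.
    by rewrite ltW // (lt_trans ltr01).
  rewrite [leLHS](_ : _ = 4 * q ^+ (m + i) *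
      l2norm (T (m + i)%N) (fun k => knorm R k `^ s * a k)); last first.
    congr (_ * _ * _); rewrite /q -!powR_mulrn ?powR_ge0 // -!powRrM.
    by rewrite mulrC -powRN -powRD ?pnatr_eq0 ?implybT //; congr (_ `^ _); ring.
  by rewrite ler_wpM2l ?aA // mulr_ge0 // exprn_ge0 // ltW.
rewrite -mulr_suml ler_wpM2r //.
under eq_bigr do rewrite exprD mulrA.
rewrite -mulr_sumr.
rewrite [leRHS](_ : _ = 4 * q ^+ m * (1 - q)^-1); last by ring.
apply: ler_wpM2l; first by rewrite mulr_ge0 // exprn_ge0 // ltW.
by apply: geometric_sum_le; rewrite (ltW q0).
Qed.

End Estimates.

(** * Sobolev bounds *)

Section SobolevBounds.
Set Implicit Arguments.
Unset Strict Implicit.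
Local Open Scope classical_set_scope.
Variable R : realType.
Local Notation conv := (@Defs.conv R).
Implicit Types (k : Z2) (S : seq Z2) (f g u v : Z2 -> R[i]).

(* [Hs_norm2] does not see the zero mode when [s > 0], hence the first conjunct. *)
Definition hs_bound (s : R) f (A : R) :=
  f (0, 0) = 0 /\
  forall S, uniq S -> l2norm S (fun k => knorm R k `^ s * cmod (f k)) <= A.

Definition l1_bound f (L : R) := bounded_sums (fun k => cmod (f k)) L.

Lemma hs_bound_ge0 s f A : hs_bound s f A -> 0 <= A.
Proof. by move=> [_ /(_ [::] isT)]; apply: le_trans; exact: l2norm_ge0. Qed.

Lemma sqr_weight s k f :
  (knorm R k `^ s * cmod (f k)) ^+ 2 = knorm R k `^ (2 * s) * cabs2 (f k).
Proof.
by rewrite exprMn sqr_cmod -powR_mulrn ?powR_ge0 // -powRrM (mulrC s).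
Qed.

Lemma hs_bound_norm2 s f A : hs_bound s f A -> (Hs_norm2 s f <= (A ^+ 2)%:E)%E.
Proof.
move=> fA; have A0 := hs_bound_ge0 fA; case: fA => _ fA.
apply: ge_ereal_sup => _ [N _ <-]; rewrite lee_fin sq_sumRE.
under eq_bigr do rewrite -sqr_weight.
by rewrite -l2norm_leP // fA // square_uniq.
Qed.

(** Every finite set of frequencies lies in a square, where the partial sum is bounded by the
    supremum. *)
Lemma norm2_hs_bound s f M : f (0, 0) = 0 -> (Hs_norm2 s f <= M%:E)%E ->
  hs_bound s f (Num.sqrt M).
Proof.
move=> f0 fM; split=> // S uS.
have sqM N : \sum_(k <- square N) (knorm R k `^ s * cmod (f k)) ^+ 2 <= M.
  under eq_bigr do rewrite sqr_weight.
  rewrite -sq_sumRE -lee_fin; apply: le_trans fM.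
  by apply: ereal_sup_ubound; exists N.
have [N SN] := sub_square S.
apply: ler_wsqrtr; apply: le_trans (sqM N).
by apply: ler_sum_subset => // k; exact: sqr_ge0.
Qed.

Lemma hs_bound_le s f A B : hs_bound s f A -> A <= B -> hs_bound s f B.
Proof. by move=> [f0 fA] AB; split=> // S /fA /le_trans; apply. Qed.

Lemma hs_bound_eps s f A : (forall e, 0 < e -> hs_bound s f (A + e)) ->
  hs_bound s f A.
Proof.
move=> fA; split=> [|S uS]; first by have [] := fA 1 ltr01.
by apply/ler_addgt0Pr => e e0; have [_ ->] := fA e e0.
Qed.

Lemma hs_bound0 s : hs_bound s (fun=> 0) 0.
Proof.
split=> // S _; rewrite /l2norm big1 ?sqrtr0 // => k _.
by rewrite cmod0 mulr0 expr0n.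
Qed.

Lemma hs_boundD s f g A B : hs_bound s f A -> hs_bound s g B ->
  hs_bound s (fun k => f k + g k) (A + B).
Proof.
move=> [f0 fA] [g0 gB]; split=> [|S uS]; first by rewrite f0 g0 addr0.
apply: le_trans (lerD (fA S uS) (gB S uS)).
apply: le_trans (l2normD _ _ _); apply: ler_l2norm => k _.
by rewrite mulr_ge0 ?powR_ge0 ?cmod_ge0 //= -mulrDr ler_wpM2l ?powR_ge0 // cmodD.
Qed.

Lemma hs_boundN s f A : hs_bound s f A -> hs_bound s (fun k => - f k) A.
Proof.
move=> [f0 fA]; split=> [|S uS]; first by rewrite f0 oppr0.
by apply: le_trans (fA S uS); apply: ler_l2norm => k _;
  rewrite cmodN lexx mulr_ge0 ?powR_ge0 ?cmod_ge0.
Qed.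

Lemma hs_boundB s f g A B : hs_bound s f A -> hs_bound s g B ->
  hs_bound s (fun k => f k - g k) (A + B).
Proof. by move=> fA gB; exact: hs_boundD fA (hs_boundN gB). Qed.

Lemma hs_bound_lim s (u : nat -> Z2 -> R[i]) f A :
  (forall k, ccvg (u^~ k) (f k)) -> (forall n, hs_bound s (u n) A) ->
  hs_bound s f A.
Proof.
move=> uf uA; split=> [|S uS].
  apply: (ccvg_unique (uf (0, 0))).
  rewrite (_ : (fun n => _) = fun=> 0); first exact: ccvg_cst.
  by apply/funext => n; have [] := uA n.
apply: (le_cvg (cvg_l2norm (S := S) (w := fun k => knorm R k `^ s) uf)) => n.
by have [_ ->] := uA n.
Qed.

(** Nonzero integer frequencies have modulus at least 1, and the zero mode vanishes. *)
Lemma hs_bound_exp s s' f A : s' <= s -> hs_bound s f A -> hs_bound s' f A.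
Proof.
move=> ss [f0 fA]; split=> // S uS; apply: le_trans (fA S uS).
apply: ler_l2norm => k _; rewrite mulr_ge0 ?powR_ge0 ?cmod_ge0 //=.
have [->|k0] := eqVneq k (0, 0); first by rewrite f0 cmod0 !mulr0.
by rewrite ler_wpM2r ?cmod_ge0 // ler_powR // knorm_ge1.
Qed.

Lemma hs_bound_coef s f A k : 0 <= s -> hs_bound s f A -> cmod (f k) <= A.
Proof.
move=> s0 /(hs_bound_exp s0) [f0 fA].
have := fA [:: k] isT; apply: le_trans.
by rewrite /l2norm big_seq1 powRr0 mul1r sqrtr_sqr ger0_norm ?cmod_ge0.
Qed.

Definition l1_cst (s : R) : R := 4 / (1 - 2 `^ (1 - s)).

Lemma l1_cst_gt0 s : 1 < s -> 0 < l1_cst s.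
Proof. by move=> s1; rewrite divr_gt0 // subr_gt0 powR2_lt1. Qed.

Lemma hs_bound_l1_log s f M A m : 1 < s -> hs_bound 1 f M -> hs_bound s f A ->
  l1_bound f (4 * Num.sqrt m%:R * M + l1_cst s * (2 `^ (1 - s)) ^+ m * A).
Proof.
move=> s1 [f0 fM] [_ fA].
by apply: l1_log_bound => // [k|]; rewrite ?cmod_ge0 // f0 cmod0.
Qed.

Lemma hs_bound_l1 s f A : 1 < s -> hs_bound s f A -> l1_bound f (l1_cst s * A).
Proof.
(* Cutting at [m = 0] leaves no low shells, so the H^1 term disappears. *)
move=> s1 fA; have := hs_bound_l1_log 0 s1 (hs_bound_exp (ltW s1) fA) fA.
by rewrite sqrtr0 mulr0 mul0r add0r expr0 mulr1.
Qed.

(** The factor [u] is merely dominated by [f]: it will be a velocity component, so that bounds on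
    [f] serve for its Riesz transforms too. *)
Lemma conv_bounded_sums u g f L B k : (forall j, cmod (u j) <= cmod (f j)) ->
  l1_bound f L -> 0 <= B -> (forall j, cmod (g j) <= B) ->
  bounded_sums (fun j => cmod (u j * g (subZ k j))) (L * B).
Proof.
move=> uf fL B0 gB S uS; apply: (@le_trans _ _ (\sum_(j <- S) cmod (f j) * B)).
  by apply: ler_sum => j _; rewrite cmodM ler_pM ?cmod_ge0.
by rewrite -mulr_suml ler_wpM2r // fL.
Qed.

Lemma ccvg_conv s u f g A B k : 1 < s -> (forall j, cmod (u j) <= cmod (f j)) ->
  hs_bound s f A -> hs_bound s g B ->
  ccvg (fun N => \sum_(j <- square N) u j * g (subZ k j)) (conv u g k).
Proof.
move=> s1 uf fA gB; have s0 : 0 <= s by rewrite ltW // (lt_trans ltr01).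
apply: ccvg_zsum (l1_cst s * A * B) _.
apply: conv_bounded_sums uf (hs_bound_l1 s1 fA) (hs_bound_ge0 gB) _ => j.
exact: hs_bound_coef gB.
Qed.

(** The tame bound holds with the same constant for every truncation to [square N] and passes to the
    limit. *)
Lemma l2norm_conv s u f g A B Lf Lg S : 1 < s ->
  (forall j, cmod (u j) <= cmod (f j)) ->
  hs_bound s f A -> hs_bound s g B -> l1_bound f Lf -> l1_bound g Lg ->
  uniq S -> l2norm S (fun k => knorm R k `^ s * cmod (conv u g k)) <=
    2 `^ s * (Lg * A + Lf * B).
Proof.
move=> s1 uf fA gB fL gL uS; have s0 : 0 < s by rewrite (lt_trans ltr01).
apply: (le_cvg (cvg_l2norm (S := S) (w := fun k => knorm R k `^ s)
  (fun k => ccvg_conv k s1 uf fA gB))) => N.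
case: fA => _ fA; case: gB => _ gB.
apply: le_trans (tame_conv (w := fun k => knorm R k `^ s) _ _ _ _ _ uS
  (square_uniq N) fA gB fL gL) => [|k|||k|k].
- apply: ler_l2norm => k _; rewrite mulr_ge0 ?powR_ge0 ?cmod_ge0 //=.
  rewrite ler_wpM2l ?powR_ge0 //.
  elim: (square N) => [|j r IH]; first by rewrite !big_nil cmod0.
  rewrite !big_cons; apply: le_trans (cmodD _ _) _; apply: lerD => //.
  by rewrite cmodM ler_wpM2r ?cmod_ge0.
- exact: powR_ge0.
- exact: powR_ge0.
- by move=> k j; exact: powR_knorm_sub.
- exact: cmod_ge0.
- exact: cmod_ge0.
Qed.

(** [zsum] is additive only where the limits exist. The difference [u - u'] is dominated by two
    functions rather than one, so its summability is obtained by adding the two majorants. *)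
Lemma convBl s u u' f f' g A A' B k : 1 < s ->
  (forall j, cmod (u j) <= cmod (f j)) -> (forall j, cmod (u' j) <= cmod (f' j)) ->
  hs_bound s f A -> hs_bound s f' A' -> hs_bound s g B ->
  conv (fun j => u j - u' j) g k = conv u g k - conv u' g k.
Proof.
move=> s1 uf uf' fA fA' gB.
have H := ccvgD (ccvg_conv k s1 uf fA gB)
                (ccvgN (ccvg_conv k s1 uf' fA' gB)).
apply: ccvg_unique H.
have -> : (fun n => \sum_(j <- square n) u j * g (subZ k j)
    - \sum_(j <- square n) u' j * g (subZ k j)) =
  (fun n => \sum_(j <- square n) (u j - u' j) * g (subZ k j)).
  by apply/funext => n; rewrite -sumrB; apply: eq_bigr => j _; rewrite mulrBl.
have s0 : 0 <= s by rewrite ltW // (lt_trans ltr01).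
apply: ccvg_zsum (l1_cst s * A * B + l1_cst s * A' * B) _ => S uS.
have H1 := conv_bounded_sums k uf (hs_bound_l1 s1 fA) (hs_bound_ge0 gB)
  (fun j => hs_bound_coef j s0 gB) uS.
have H2 := conv_bounded_sums k uf' (hs_bound_l1 s1 fA') (hs_bound_ge0 gB)
  (fun j => hs_bound_coef j s0 gB) uS.
apply: le_trans (lerD H1 H2); rewrite -big_split /=.
by apply: ler_sum => j _; rewrite mulrBl cmodB.
Qed.

Lemma convBr s u f g g' A B B' k : 1 < s ->
  (forall j, cmod (u j) <= cmod (f j)) ->
  hs_bound s f A -> hs_bound s g B -> hs_bound s g' B' ->
  conv u (fun j => g j - g' j) k = conv u g k - conv u g' k.
Proof.
move=> s1 uf fA gB gB'.
have H := ccvgD (ccvg_conv k s1 uf fA gB)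
                (ccvgN (ccvg_conv k s1 uf fA gB')).
have H' := ccvg_conv k s1 uf fA (hs_boundB gB gB').
apply: (ccvg_unique H'); rewrite (_ : (fun n => _) = (fun n =>
  \sum_(j <- square n) u j * g (subZ k j) - \sum_(j <- square n) u j * g' (subZ k j))) //.
by apply/funext => n; rewrite -sumrB; apply: eq_bigr => j _; rewrite mulrBr.
Qed.

(** The Fourier side of being real-valued, as required by [in_Hs]. *)
Definition hermitian f := forall k, f (negZ k) = cconj (f k).

Lemma hermitian_conv s u f g A B : 1 < s ->
  (forall j, cmod (u j) <= cmod (f j)) ->
  hs_bound s f A -> hs_bound s g B -> hermitian u -> hermitian g ->
  hermitian (conv u g).
Proof.
move=> s1 uf fA gB hu hg k.
apply: (ccvg_unique (ccvg_conv (negZ k) s1 uf fA gB)).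
have [H1 H2] := ccvg_conv k s1 uf fA gB.
have E n : \sum_(j <- square n) u j * g (subZ (negZ k) j) =
    cconj (\sum_(j <- square n) u j * g (subZ k j)).
  rewrite (perm_big _ (perm_square_neg n)) big_map.
  rewrite (big_morph (@cconj R) (@cconjD R) (id1 := 0)); last first.
    by apply: complexP => //=; rewrite oppr0.
  apply: eq_bigr => j _; rewrite hu cconjM -hg; congr (_ * g _).
  by rewrite /subZ /negZ /= !opprK !opprB; congr pair; rewrite addrC.
split.
  by under eq_fun do rewrite E /=.
by under eq_fun do rewrite E /=; exact: cvgN.
Qed.

End SobolevBounds.

(** * The bilinear form *)

Section BilinearForm.
Set Implicit Arguments.
Unset Strict Implicit.
Local Open Scope classical_set_scope.
Variable R : realType.
Implicit Types (k : Z2) (S : seq Z2) (f g : Z2 -> R[i]) (D : set R).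
Local Notation conv := (@Defs.conv R).

(* Polarization of the quadratic [qg_rhs]: [qg_rhs 2^-1 mu f] is [bil mu f f]. *)
Definition bil (mu : R) f g k : R[i] :=
  cR (1 + mu * knorm R k `^ (2 * 2^-1))^-1 *
  div_hat (conv (vel1 f) g) (conv (vel2 f) g) k.

Lemma cmod_riesz (x : R) k (z : R[i]) : `|x| <= knorm R k ->
  cmod (- cI R * cR (x / knorm R k) * z) <= cmod z.
Proof.
move=> xk; rewrite mulNr mulNr cmodN !cmodM cmod_cI mul1r cmod_cR.
rewrite ler_piMl ?cmod_ge0 // normrM normfV (ger0_norm (knorm_ge0 R k)).
(* At zero frequency the quotient is 0 by the convention for division. *)
have [->|k0] := eqVneq (knorm R k) 0; first by rewrite invr0 mulr0.
by rewrite ler_pdivrMr ?mul1r // lt_neqAle eq_sym k0 knorm_ge0.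
Qed.

Lemma cmod_vel1 f k : cmod (vel1 f k) <= cmod (f k).
Proof.
rewrite /vel1 /riesz2 cmodN; case: eqP => _; first by rewrite cmod0 cmod_ge0.
exact/cmod_riesz/abs_k2_le.
Qed.

Lemma cmod_vel2 f k : cmod (vel2 f k) <= cmod (f k).
Proof.
rewrite /vel2 /riesz1; case: eqP => _; first by rewrite cmod0 cmod_ge0.
exact/cmod_riesz/abs_k1_le.
Qed.

Lemma vel1B f g : vel1 (fun k => f k - g k) = fun k => vel1 f k - vel1 g k.
Proof.
apply/funext => k; rewrite /vel1 /riesz2; case: eqP => _; last by rewrite mulrBr opprD.
by rewrite oppr0 subr0.
Qed.

Lemma vel2B f g : vel2 (fun k => f k - g k) = fun k => vel2 f k - vel2 g k.
Proof.
apply/funext => k; rewrite /vel2 /riesz1; case: eqP => _; last by rewrite mulrBr.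
by rewrite subr0.
Qed.

Lemma negZ_eq0 k : (negZ k == (0, 0)) = (k == (0, 0)).
Proof. by case: k => a b; rewrite !xpair_eqE !oppr_eq0. Qed.

Lemma cconj0 : cconj (0 : R[i]) = 0.
Proof. by apply: complexP => //=; rewrite oppr0. Qed.

(** The symbol is imaginary and odd in the frequency, so reflection conjugates it: the velocity of a
    real field is real. *)
Lemma riesz_conj (x y : R) (z : R[i]) :
  - cI R * cR (- x / y) * cconj z = cconj (- cI R * cR (x / y) * z).
Proof.
rewrite !cconjM cconjN cconj_cI cconj_cR; congr (_ * _).
by apply: complexP => /=; ring.
Qed.

Lemma hermitian_vel1 f : hermitian f -> hermitian (vel1 f).
Proof.
move=> hf k; rewrite /vel1 /riesz2 cconjN negZ_eq0; case: ifP => _; first by rewrite cconj0.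
by rewrite hf knormN {1}/k2 /= rmorphN riesz_conj.
Qed.

Lemma hermitian_vel2 f : hermitian f -> hermitian (vel2 f).
Proof.
move=> hf k; rewrite /vel2 /riesz1 negZ_eq0; case: ifP => _; first by rewrite cconj0.
by rewrite hf knormN {1}/k1 /= rmorphN riesz_conj.
Qed.

Lemma hermitian_bil mu s f A : 1 < s -> hs_bound s f A -> hermitian f ->
  hermitian (bil mu f f).
Proof.
move=> s1 fA hf k; rewrite /bil /div_hat.
rewrite (hermitian_conv s1 (cmod_vel1 f) fA fA (hermitian_vel1 hf) hf).
rewrite (hermitian_conv s1 (cmod_vel2 f) fA fA (hermitian_vel2 hf) hf).
rewrite knormN cconjM cconj_cR; congr (_ * _).
rewrite cconjM cconj_cI cconjD !cconjM !cconj_cR /k1 /k2 /= !rmorphN /=.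
have cRN (x : R) : cR (- x) = - cR x by apply: complexP => //=; rewrite oppr0.
by rewrite !cRN; ring.
Qed.

Definition tame_cst (mu s : R) : R := 2 / mu * 2 `^ s.

Lemma tame_cst_gt0 mu s : 0 < mu -> 0 < tame_cst mu s.
Proof. by move=> mu0; rewrite mulr_gt0 ?powR_gt0 // divr_gt0. Qed.

(* The multiplier [(1 + mu |k|)^-1 |k| <= mu^-1] absorbs the derivative: this is where
   [alpha = 1/2] enters. *)
Lemma cmod_bil mu f g k : 0 < mu -> cmod (bil mu f g k) <=
  mu^-1 * (cmod (conv (vel1 f) g k) + cmod (conv (vel2 f) g k)).
Proof.
move=> mu0; rewrite /bil /div_hat !cmodM cmod_cI mul1r cmod_cR.
rewrite divff ?pnatr_eq0 // powRr1 ?knorm_ge0 //.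
set z := knorm R k; have z0 : 0 <= z by exact: knorm_ge0.
have p : 0 < 1 + mu * z by rewrite ltr_wpDr // mulr_ge0 // ltW.
apply: (@le_trans _ _ ((1 + mu * z)^-1 *
  (z * (cmod (conv (vel1 f) g k) + cmod (conv (vel2 f) g k))))).
  rewrite ger0_norm ?invr_ge0 ?(ltW p) // ler_wpM2l ?invr_ge0 ?(ltW p) //.
  apply: le_trans (cmodD _ _) _; rewrite mulrDr !cmodM !cmod_cR.
  by apply: lerD; rewrite ler_wpM2r ?cmod_ge0 ?abs_k1_le ?abs_k2_le.
rewrite mulrA ler_wpM2r ?addr_ge0 ?cmod_ge0 // ler_pdivrMl //.
rewrite mulrDl mul1r mulrAC divff ?gt_eqF // mul1r lerDr invr_ge0 ltW //.
Qed.

Lemma hs_bound_bil mu s f g A B Lf Lg : 0 < mu -> 1 < s ->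
  hs_bound s f A -> hs_bound s g B -> l1_bound f Lf -> l1_bound g Lg ->
  hs_bound s (bil mu f g) (tame_cst mu s * (Lg * A + Lf * B)).
Proof.
move=> mu0 s1 fA gB fL gL; split=> [|S uS].
  (* The zero mode vanishes because the nonlinearity is a divergence. *)
  rewrite /bil /div_hat /k1 /k2 /=; set c1 := conv _ _ _; set c2 := conv _ _ _.
  rewrite (_ : cR 0 = 0 :> R[i]); last exact: complexP.
  by rewrite !mul0r addr0 !mulr0.
have n1 := l2norm_conv s1 (cmod_vel1 f) fA gB fL gL uS.
have n2 := l2norm_conv s1 (cmod_vel2 f) fA gB fL gL uS.
apply: (@le_trans _ _ (l2norm S (fun k => mu^-1 *
    (knorm R k `^ s * cmod (conv (vel1 f) g k) +
     knorm R k `^ s * cmod (conv (vel2 f) g k))))).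
  apply: ler_l2norm => k _; rewrite mulr_ge0 ?powR_ge0 ?cmod_ge0 //=.
  by rewrite -mulrDr mulrCA ler_wpM2l ?powR_ge0 // cmod_bil.
rewrite l2normZ ?invr_ge0 ?(ltW mu0) //.
rewrite [leRHS](_ : _ = mu^-1 * (2 `^ s * (Lg * A + Lf * B) + 2 `^ s * (Lg * A + Lf * B))).
  rewrite ler_wpM2l ?invr_ge0 ?(ltW mu0) //.
  exact: le_trans (l2normD S (fun k => knorm R k `^ s * cmod (conv (vel1 f) g k))
    (fun k => knorm R k `^ s * cmod (conv (vel2 f) g k))) (lerD n1 n2).
rewrite /tame_cst; ring.
Qed.

(** The tame estimate with both l^1 norms replaced by [l1_cst s] times H^s bounds, whence two equal
    terms. *)
Definition bil_cst (mu s : R) : R := 2 * tame_cst mu s * l1_cst s.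

Lemma bil_cst_gt0 mu s : 0 < mu -> 1 < s -> 0 < bil_cst mu s.
Proof. by move=> mu0 s1; apply: mulr_gt0; [rewrite mulr_gt0 ?tame_cst_gt0|exact: l1_cst_gt0]. Qed.

Lemma hs_bound_bil_crude mu s f g A B : 0 < mu -> 1 < s ->
  hs_bound s f A -> hs_bound s g B -> hs_bound s (bil mu f g) (bil_cst mu s * A * B).
Proof.
move=> mu0 s1 fA gB.
have H := hs_bound_bil mu0 s1 fA gB (hs_bound_l1 s1 fA) (hs_bound_l1 s1 gB).
by apply: (hs_bound_le H); rewrite /bil_cst le_eqVlt; apply/orP; left; apply/eqP; ring.
Qed.

Lemma bil_diff mu s f g A B k : 1 < s -> hs_bound s f A -> hs_bound s g B ->
  bil mu f f k - bil mu g g k =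
  bil mu (fun j => f j - g j) f k + bil mu g (fun j => f j - g j) k.
Proof.
move=> s1 fA gB; rewrite /bil /div_hat vel1B vel2B.
rewrite (convBl k s1 (cmod_vel1 f) (cmod_vel1 g) fA gB fA).
rewrite (convBl k s1 (cmod_vel2 f) (cmod_vel2 g) fA gB fA).
rewrite (convBr k s1 (cmod_vel1 g) gB fA gB) (convBr k s1 (cmod_vel2 g) gB fA gB).
ring.
Qed.

Lemma hs_bound_bil_diff mu s f g A d : 0 < mu -> 1 < s ->
  hs_bound s f A -> hs_bound s g A -> hs_bound s (fun k => f k - g k) d ->
  hs_bound s (fun k => bil mu f f k - bil mu g g k) (2 * bil_cst mu s * A * d).
Proof.
move=> mu0 s1 fA gA fgd.
rewrite (_ : (fun k => _) = fun k => bil mu (fun j => f j - g j) f k +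
   bil mu g (fun j => f j - g j) k); last first.
  by apply/funext => k; exact: bil_diff s1 fA gA.
have H := hs_boundD (hs_bound_bil_crude mu0 s1 fgd fA) (hs_bound_bil_crude mu0 s1 gA fgd).
by apply: (hs_bound_le H); rewrite le_eqVlt; apply/orP; left; apply/eqP; ring.
Qed.

(** * Measurability in time *)

Definition cmeasurable D (F : R -> R[i]) :=
  measurable_fun D (fun t => cre (F t)) /\ measurable_fun D (fun t => cim (F t)).

Lemma cmeasurable_cst D (z : R[i]) : cmeasurable D (fun=> z).
Proof. by split; exact: measurable_cst. Qed.

Lemma cmeasurableD D F G : cmeasurable D F -> cmeasurable D G ->
  cmeasurable D (fun t => F t + G t).
Proof.
move=> [F1 F2] [G1 G2]; split.
  by under eq_fun do rewrite creD; exact: measurable_funD.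
by under eq_fun do rewrite cimD; exact: measurable_funD.
Qed.

Lemma cmeasurableN D F : cmeasurable D F -> cmeasurable D (fun t => - F t).
Proof.
move=> [F1 F2]; split.
  by under eq_fun do rewrite creN; exact: measurable_funN.
by under eq_fun do rewrite cimN; exact: measurable_funN.
Qed.

Lemma cmeasurableM D F G : cmeasurable D F -> cmeasurable D G ->
  cmeasurable D (fun t => F t * G t).
Proof.
move=> [F1 F2] [G1 G2]; split.
  under eq_fun do rewrite creM.
  by apply: measurable_funB; exact: measurable_funM.
under eq_fun do rewrite cimM.
by apply: measurable_funD; exact: measurable_funM.
Qed.

Lemma cmeasurable_sum D (r : seq Z2) (F : Z2 -> R -> R[i]) :
  (forall k, cmeasurable D (F k)) -> cmeasurable D (fun t => \sum_(k <- r) F k t).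
Proof.
move=> mF; elim: r => [|k r IH].
  by under eq_fun do rewrite big_nil; exact: cmeasurable_cst.
by under eq_fun do rewrite big_cons; exact: cmeasurableD.
Qed.

Lemma cmeasurable_lim D (u : nat -> R -> R[i]) F :
  (forall n, cmeasurable D (u n)) -> (forall t, D t -> ccvg (u^~ t) (F t)) ->
  cmeasurable D F.
Proof.
move=> mu uF; split.
  apply: (@measurable_fun_cvg _ _ _ _ (fun n t => cre (u n t))) => [n|t Dt].
    by have [] := mu n.
  by have [] := uF t Dt.
apply: (@measurable_fun_cvg _ _ _ _ (fun n t => cim (u n t))) => [n|t Dt].
  by have [] := mu n.
by have [] := uF t Dt.
Qed.

Lemma cmeasurable_vel1 D (th : R -> Z2 -> R[i]) :
  (forall k, cmeasurable D (th^~ k)) -> forall k, cmeasurable D (fun t => vel1 (th t) k).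
Proof.
move=> mth k; apply: cmeasurableN; rewrite /riesz2; case: eqP => _.
  exact: cmeasurable_cst.
exact/cmeasurableM/mth/cmeasurable_cst.
Qed.

Lemma cmeasurable_vel2 D (th : R -> Z2 -> R[i]) :
  (forall k, cmeasurable D (th^~ k)) -> forall k, cmeasurable D (fun t => vel2 (th t) k).
Proof.
move=> mth k; rewrite /vel2 /riesz1; case: eqP => _; first exact: cmeasurable_cst.
exact/cmeasurableM/mth/cmeasurable_cst.
Qed.

Lemma cmeasurable_conv D s A (u th : R -> Z2 -> R[i]) k : 1 < s ->
  (forall t, D t -> hs_bound s (th t) A) ->
  (forall t j, cmod (u t j) <= cmod (th t j)) ->
  (forall j, cmeasurable D (u^~ j)) -> (forall j, cmeasurable D (th^~ j)) ->
  cmeasurable D (fun t => conv (u t) (th t) k).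
Proof.
move=> s1 thA uth mu mth.
apply: (@cmeasurable_lim D
  (fun N t => \sum_(j <- square N) u t j * th t (subZ k j))) => [n|t Dt].
  by apply: cmeasurable_sum => j; exact: cmeasurableM.
exact: (ccvg_conv k s1 (uth t) (thA t Dt) (thA t Dt)).
Qed.

Lemma cmeasurable_bil D mu s A (th : R -> Z2 -> R[i]) k : 1 < s ->
  (forall t, D t -> hs_bound s (th t) A) ->
  (forall j, cmeasurable D (th^~ j)) ->
  cmeasurable D (fun t => bil mu (th t) (th t) k).
Proof.
move=> s1 thA mth.
have m1 := cmeasurable_conv k s1 thA (fun t => cmod_vel1 (th t)) (cmeasurable_vel1 mth) mth.
have m2 := cmeasurable_conv k s1 thA (fun t => cmod_vel2 (th t)) (cmeasurable_vel2 mth) mth.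
apply: cmeasurableM; first exact: cmeasurable_cst.
apply: cmeasurableM; first exact: cmeasurable_cst.
by apply: cmeasurableD; apply: cmeasurableM => //; exact: cmeasurable_cst.
Qed.

End BilinearForm.

(** * Time integrals *)

Section TimeIntegral.
Set Implicit Arguments.
Unset Strict Implicit.
Local Open Scope classical_set_scope.
Variable R : realType.
Implicit Types (k : Z2) (S : seq Z2) (r t : R).
Local Notation leb := (@lebesgue_measure R).

Definition cintegrable (D : set R) (F : R -> R[i]) :=
  leb.-integrable D (EFin \o (fun x => cre (F x))) /\
  leb.-integrable D (EFin \o (fun x => cim (F x))).

Definition cint (D : set R) (F : R -> R[i]) : R[i] :=
  Complex (Rintegral leb D (fun x => cre (F x))) (Rintegral leb D (fun x => cim (F x))).

Lemma measurable_ccitv r t : measurable (`[r, t] : set R).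
Proof. exact: measurable_itv. Qed.

Lemma leb_ccitv_fin r t : (leb `[r, t] < +oo)%E.
Proof. by rewrite lebesgue_measure_itv /=; case: ifP => // _; rewrite ltry. Qed.

Lemma integrable_addr D (f g : R -> R) : measurable D ->
  leb.-integrable D (EFin \o f) -> leb.-integrable D (EFin \o g) ->
  leb.-integrable D (EFin \o (fun x => f x + g x)).
Proof.
by move=> mD fi gi; apply: eq_integrable (integrableD mD fi gi).
Qed.

Lemma integrable_scaler D (c : R) (f : R -> R) : measurable D ->
  leb.-integrable D (EFin \o f) -> leb.-integrable D (EFin \o (fun x => c * f x)).
Proof.
by move=> mD fi; apply: eq_integrable (integrableZl mD c fi).
Qed.

Lemma Rintegral_sum (I : Type) (l : seq I) (D : set R) (f : I -> R -> R) :
  measurable D -> (forall i, leb.-integrable D (EFin \o f i)) ->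
  leb.-integrable D (EFin \o (fun x => \sum_(i <- l) f i x)) /\
  Rintegral leb D (fun x => \sum_(i <- l) f i x) = \sum_(i <- l) Rintegral leb D (f i).
Proof.
move=> mD fi; elim: l => [|i l [IH1 IH2]].
  rewrite big_nil (_ : (fun x => _) = fun=> 0); last first.
    by apply/funext => x; rewrite big_nil.
  split; first exact: integrable0.
  by rewrite Rintegral_cst // mul0r.
rewrite big_cons (_ : (fun x => _) = fun x => f i x + \sum_(j <- l) f j x); last first.
  by apply/funext => x; rewrite big_cons.
split; last by rewrite RintegralD // IH2.
exact: integrable_addr.
Qed.

Lemma fine_leb_itv r t : r <= t -> fine (leb `[r, t]) = t - r.
Proof.
move=> rt; rewrite lebesgue_measure_itv /= lte_fin.
have [//|tr] := ltrP r t.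
by rewrite (@le_anti _ _ r t) ?rt ?tr // subrr.
Qed.

Lemma Rintegral_le_cst r t (f : R -> R) c : r <= t ->
  leb.-integrable `[r, t] (EFin \o f) -> (forall x, r <= x <= t -> f x <= c) ->
  Rintegral leb `[r, t] f <= (t - r) * c.
Proof.
move=> rt fi fc.
have ci : leb.-integrable `[r, t] (EFin \o (fun=> c)).
  apply: measurable_bounded_integrable => //.
  - exact: leb_ccitv_fin.
  - by exists `|c|; split=> [|x cx y _ /=]; rewrite ?num_real // ltW.
apply: le_trans (le_Rintegral _ fi ci _) _ => //.
by rewrite Rintegral_cst // fine_leb_itv // mulrC.
Qed.

(* Minkowski's integral inequality by duality: pair the integral with itself. *)
Lemma hs_bound_cint s (F : R -> Z2 -> R[i]) r t G : r <= t ->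
  (forall x, r <= x <= t -> hs_bound s (F x) G) ->
  (forall k, cintegrable `[r, t] (fun x => F x k)) ->
  hs_bound s (fun k => cint `[r, t] (fun x => F x k)) ((t - r) * G).
Proof.
move=> rt FG Fi; set v := fun k => _.
have G0 : 0 <= G by apply: (hs_bound_ge0 (FG r _)); rewrite lexx.
split=> [|S uS].
  rewrite /v /cint (@eq_Rintegral _ _ _ leb _ (fun=> 0)) ?Rintegral_cst // ?mul0r.
    rewrite (@eq_Rintegral _ _ _ leb _ (fun=> 0)) ?Rintegral_cst // ?mul0r //.
    by move=> x /set_mem /=; rewrite in_itv /= => /FG [-> _].
  by move=> x /set_mem /=; rewrite in_itv /= => /FG [-> _].
set N := l2norm S _.
have N0 : 0 <= N by exact: l2norm_ge0.
suff H : N ^+ 2 <= (t - r) * (N * G).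
  have [->|Nn0] := eqVneq N 0; first by rewrite mulr_ge0 // subr_ge0.
  have Np : 0 < N by rewrite lt_neqAle eq_sym Nn0.
  by rewrite -(ler_pM2l Np) mulrCA -expr2.
pose w k := knorm R k `^ s.
(* Weighted real inner product of [v k] with [F x k]; its integral over [x], summed over [S], is
   [N ^+ 2]. *)
pose f k x := w k ^+ 2 * cre (v k) * cre (F x k) + w k ^+ 2 * cim (v k) * cim (F x k).
have fi k : leb.-integrable `[r, t] (EFin \o f k).
  have [F1 F2] := Fi k.
  by apply: integrable_addr => //; exact: integrable_scaler.
have [si sE] := Rintegral_sum S (measurable_ccitv r t) fi.
have -> : N ^+ 2 = Rintegral leb `[r, t] (fun x => \sum_(k <- S) f k x).
  rewrite sE /N sqr_l2norm; apply: eq_bigr => k _.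
  have [F1 F2] := Fi k.
  rewrite /f RintegralD //; last 2 first.
  - exact: integrable_scaler.
  - exact: integrable_scaler.
  rewrite !RintegralZl // exprMn sqr_cmod /cabs2 -/(w k) /v /=; ring.
apply: Rintegral_le_cst => // x /FG [_ FxG].
apply: (@le_trans _ _ (\sum_(k <- S) (w k * cmod (v k)) * (w k * cmod (F x k)))).
  apply: ler_sum => k _.
  rewrite [leLHS](_ : _ = w k ^+ 2 * (cre (v k) * cre (F x k) + cim (v k) * cim (F x k)));
    last by rewrite /f; ring.
  rewrite [leRHS](_ : _ = w k ^+ 2 * (cmod (v k) * cmod (F x k))); last by ring.
  by rewrite ler_wpM2l ?sqr_ge0 // dot_le_cmod.
apply: le_trans (cauchy_schwarz_sum _ _ _) _.
by rewrite ler_wpM2l // FxG.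
Qed.

Lemma cintegrable_bounded r t F A : cmeasurable `[r, t] F ->
  (forall x, r <= x <= t -> cmod (F x) <= A) -> cintegrable `[r, t] F.
Proof.
move=> [m1 m2] FA.
have fin := leb_ccitv_fin r t.
split; apply: measurable_bounded_integrable => //; exists A; split; rewrite ?num_real //.
  move=> x Ax y /=; rewrite in_itv /= => /FA FyA.
  by rewrite (le_trans (cre_le_cmod _)) // (le_trans FyA) // ltW.
move=> x Ax y /=; rewrite in_itv /= => /FA FyA.
by rewrite (le_trans (cim_le_cmod _)) // (le_trans FyA) // ltW.
Qed.

Lemma cmeasurable_cint r t F : r <= t -> cintegrable `[r, t] F ->
  cmeasurable `[r, t] (fun x => cint `[r, x] F).
Proof.
move=> rt [F1 F2]; split; apply: subspace_continuous_measurable_fun => //.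
  exact: (parameterized_integral_continuous rt F1).
exact: (parameterized_integral_continuous rt F2).
Qed.

Lemma sub_itv (a b c d : R) : a <= c -> d <= b -> `[c, d] `<=` `[a, b].
Proof.
move=> ac db x /=; rewrite !in_itv /= => /andP[cx xd].
by rewrite (le_trans ac) // (le_trans xd).
Qed.

Lemma cintegrable_sub (a b c d : R) F : a <= c -> d <= b ->
  cintegrable `[a, b] F -> cintegrable `[c, d] F.
Proof.
move=> ac db [F1 F2].
by split; [apply: integrableS F1|apply: integrableS F2] => //; exact: sub_itv.
Qed.

Lemma cint_split (a r t : R) F : a <= r -> r <= t -> cintegrable `[a, t] F ->
  cint `[a, t] F = cint `[a, r] F + cint `[r, t] F.
Proof.
move=> ar rt Fi; have [F1 F2] := Fi; have [G1 G2] := cintegrable_sub ar (lexx t) Fi.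
have E (f : R -> R) : leb.-integrable `[a, t] (EFin \o f) ->
    Rintegral leb `[a, t] f = Rintegral leb `[a, r] f + Rintegral leb `[r, t] f.
  move=> fi.
  have := @Rintegral_itvB R f (BLeft a) (BRight t) r fi.
  rewrite !bnd_simp => /(_ ar rt) /eqP; rewrite subr_eq => /eqP ->.
  rewrite addrC Rintegral_itv_obnd_cbnd //.
  apply: integrableS fi => //; move=> x /=; rewrite !in_itv /= => /andP[rx ->].
  by rewrite (le_trans ar) // ltW.
by apply: complexP => /=; rewrite ?creD ?cimD /= E.
Qed.

Lemma cint_ext (D : set R) F G : (forall x, D x -> F x = G x) ->
  cint D F = cint D G.
Proof.
move=> FG; rewrite /cint; congr Complex; apply: eq_Rintegral => x /set_mem /FG -> //.
Qed.

Lemma cintB r t F G : cintegrable `[r, t] F -> cintegrable `[r, t] G ->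
  cint `[r, t] F - cint `[r, t] G = cint `[r, t] (fun x => F x - G x).
Proof.
move=> [F1 F2] [G1 G2]; apply: complexP.
  rewrite creD creN /= -RintegralB //.
  by apply: eq_Rintegral => x _; rewrite creD creN.
rewrite cimD cimN /= -RintegralB //.
by apply: eq_Rintegral => x _; rewrite cimD cimN.
Qed.

Lemma cintegrableB r t F G : cintegrable `[r, t] F -> cintegrable `[r, t] G ->
  cintegrable `[r, t] (fun x => F x - G x).
Proof.
move=> [F1 F2] [G1 G2]; have mI := measurable_ccitv r t; split.
  apply: eq_integrable (integrable_addr mI F1 (integrable_scaler (-1) mI G1)) => // x _ /=.
  by rewrite creD creN mulN1r.
apply: eq_integrable (integrable_addr mI F2 (integrable_scaler (-1) mI G2)) => // x _ /=.
by rewrite cimD cimN mulN1r.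
Qed.

End TimeIntegral.

(** * Local existence *)

Section LocalExistence.
Set Implicit Arguments.
Unset Strict Implicit.
Local Open Scope classical_set_scope.
Variable R : realType.
Implicit Types (k : Z2) (x y : R -> Z2 -> R[i]).

(** * Sequences converging at a geometric rate *)

Lemma cvg_half_pow (C : R) : (fun n => C * 2^-1 ^+ n) @ \oo --> (0 : R).
Proof.
have : `|2^-1 : R| < 1 by rewrite ger0_norm ?invr_ge0 // invf_lt1 // ltr1n.
by move=> /(@cvg_geometric R C); apply: cvg_trans.
Qed.

Lemma cvg_half_pow_diff (u : nat -> R) (A : R) :
  (forall n, `|u n.+1 - u n| <= A * 2^-1 ^+ n) -> cvgn u.
Proof.
move=> uA; have A0 : 0 <= A.
  by have := uA 0%N; rewrite expr0 mulr1; apply: le_trans.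
(* The subtracted term drops by [A * 2^-1 ^+ n] at each step, which makes [v] nondecreasing. *)
pose v n := u n - 2 * A * 2^-1 ^+ n.
have vE n : v n.+1 - v n = (u n.+1 - u n) + A * 2^-1 ^+ n by rewrite /v exprS; field.
have cv : cvgn v.
  apply: nondecreasing_is_cvgn.
    apply/nondecreasing_seqP => n; rewrite -subr_ge0 vE.
    by have := uA n; rewrite ler_norml => /andP[]; lra.
  exists (u 0%N + 2 * A) => _ [n _ <-].
  have H m : u m <= u 0%N + 2 * A - 2 * A * 2^-1 ^+ m.
    elim: m => [|m IH]; first by rewrite expr0; lra.
    have := uA m; rewrite ler_norml => /andP[_]; rewrite exprS; lra.
  rewrite /v; have := H n.
  have : 0 <= 2 * A * 2^-1 ^+ n by rewrite !mulr_ge0 // exprn_ge0 // invr_ge0.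
  lra.
rewrite (_ : u = fun n => v n + 2 * A * 2^-1 ^+ n); last first.
  by apply/funext => n; rewrite subrK.
by apply: is_cvgD => //; apply/cvg_ex; exists 0; exact: cvg_half_pow.
Qed.

Lemma ccvg_half_pow (u : nat -> R[i]) l (C : R) :
  (forall n, cmod (u n - l) <= C * 2^-1 ^+ n) -> ccvg u l.
Proof.
move=> uC.
have H (v : nat -> R) (a : R) :
    (forall n, `|v n - a| <= C * 2^-1 ^+ n) -> v @ \oo --> a.
  move=> vC; rewrite (_ : v = fun n => a + (v n - a)); last first.
    by apply/funext => n; rewrite addrC subrK.
  rewrite -[X in _ --> X]addr0; apply: cvgD; first exact: cvg_cst.
  apply/cvgr0Pnorm_le => e e0.
  have /cvgr0Pnorm_le /(_ e e0) := cvg_half_pow C.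
  by apply: filterS => n; apply: le_trans; rewrite (le_trans (vC n)) // ler_norm.
split; apply: H => n; apply: le_trans (uC n).
  by rewrite -creN -creD cre_le_cmod.
by rewrite -cimN -cimD cim_le_cmod.
Qed.

Lemma ccvg_half_pow_diff (u : nat -> R[i]) (A : R) :
  (forall n, cmod (u n.+1 - u n) <= A * 2^-1 ^+ n) ->
  ccvg u (Complex (limn (fun n => cre (u n))) (limn (fun n => cim (u n)))).
Proof.
move=> uA; split => /=; apply: (@cvg_half_pow_diff _ A) => n; apply: le_trans (uA n).
  by rewrite -creN -creD cre_le_cmod.
by rewrite -cimN -cimD cim_le_cmod.
Qed.

Variables (mu s : R).
Hypotheses (mu_gt0 : 0 < mu) (s_gt1 : 1 < s).

Let s_ge0 : 0 <= s. Proof. by rewrite ltW // (lt_trans ltr01). Qed.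

(** Working form of [qg_solution], with a free initial time for restarts and an explicit norm bound;
    integrability is recovered by [cintegrable_bil]. *)
Definition mild_solution (r t : R) (phi : Z2 -> R[i]) x (A : R) :=
  [/\ forall a, r <= a <= t -> hs_bound s (x a) A,
      forall a, r <= a <= t -> hermitian (x a),
      forall k, cmeasurable `[r, t] (x^~ k) &
      forall a, r <= a <= t -> forall k,
        x a k = phi k - cint `[r, a] (fun b => bil mu (x b) (x b) k)].

(** A mild solution without the equation: the ball on which the Picard map acts. *)
Definition admissible (r t A : R) x :=
  [/\ forall a, r <= a <= t -> hs_bound s (x a) A,
      forall a, r <= a <= t -> hermitian (x a) &
      forall k, cmeasurable `[r, t] (x^~ k)].

Lemma mild_admissible r t phi x A : mild_solution r t phi x A -> admissible r t A x.
Proof. by case. Qed.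

Lemma cintegrable_bil r t A x a b k : admissible r t A x -> r <= a -> b <= t ->
  cintegrable `[a, b] (fun c => bil mu (x c) (x c) k).
Proof.
move=> [xA _ xm] ra bt; apply: (cintegrable_sub ra bt).
apply: (@cintegrable_bounded _ _ _ _ (bil_cst mu s * A * A)).
  by apply: (cmeasurable_bil _ _ (A := A) s_gt1) => // c /=; rewrite in_itv.
move=> c /xA cA.
exact: hs_bound_coef s_ge0 (hs_bound_bil_crude mu_gt0 s_gt1 cA cA).
Qed.

Lemma cconj_cint (a b : R) (F : R -> R[i]) : cintegrable `[a, b] F ->
  cconj (cint `[a, b] F) = cint `[a, b] (fun c => cconj (F c)).
Proof.
move=> [_ F2]; apply: complexP => //=.
rewrite -mulN1r -RintegralZl //.
by apply: eq_Rintegral => c _; rewrite mulN1r.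
Qed.

(** * Picard iteration on a short interval *)

Section Picard.
Variables (r delta A : R) (phi : Z2 -> R[i]).
Hypotheses (delta_ge0 : 0 <= delta) (phiA : hs_bound s phi A) (phi_herm : hermitian phi).
(** With [K] for [bil_cst mu s], the ball of radius [2 * A] is preserved once
    [4 * K * A * delta <= 1]; the contraction factor is [4 * K * A * delta], and the 8 brings it
    down to one half. *)
Hypothesis small : 8 * bil_cst mu s * A * delta <= 1.

Definition picard x : R -> Z2 -> R[i] :=
  fun a k => phi k - cint `[r, a] (fun b => bil mu (x b) (x b) k).

Let t := r + delta.
Let rt : r <= t. Proof. by rewrite lerDl. Qed.
Let A_ge0 : 0 <= A. Proof. exact: hs_bound_ge0 phiA. Qed.
Let K_ge0 : 0 <= bil_cst mu s. Proof. exact/ltW/bil_cst_gt0. Qed.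

Lemma hs_bound_duhamel (F : R -> Z2 -> R[i]) a G : r <= a <= t ->
  (forall b, r <= b <= t -> hs_bound s (F b) G) ->
  (forall k, cintegrable `[r, a] (F^~ k)) ->
  hs_bound s (fun k => cint `[r, a] (F^~ k)) (delta * G).
Proof.
move=> /andP[ra at_] FG Fi.
have G0 : 0 <= G by apply: (hs_bound_ge0 (FG r _)); rewrite lexx.
have := hs_bound_cint ra (G := G) _ Fi => /(_ s) H.
apply: (hs_bound_le (H _)).
  by move=> b /andP[rb ba]; apply: FG; rewrite rb (le_trans ba).
by rewrite ler_wpM2r // lerBlDl.
Qed.

Lemma picard_admissible x : admissible r t (2 * A) x ->
  admissible r t (2 * A) (picard x).
Proof.
move=> xadm; have [xA xh xm] := xadm.
have xi a b k : r <= a -> b <= t -> _ := cintegrable_bil k xadm.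
split=> [a rat|a rat k|k].
- have /andP[ra at_] := rat.
  apply: (hs_bound_le (hs_boundB phiA (hs_bound_duhamel rat
    (G := bil_cst mu s * (2 * A) * (2 * A)) _ _))).
  + by move=> b /xA bA; exact: hs_bound_bil_crude.
  + by move=> k; apply: xi.
  + have : (8 * bil_cst mu s * A * delta) * A <= 1 * A by rewrite ler_wpM2r.
    have := A_ge0; lra.
- have /andP[ra at_] := rat.
  rewrite /picard phi_herm cconjD cconjN cconj_cint; last exact: xi.
  congr (_ - _); apply: cint_ext => b /=; rewrite in_itv /= => /andP[rb ba].
  have rbt : r <= b <= t by rewrite rb (le_trans ba).
  exact: hermitian_bil s_gt1 (xA b rbt) (xh b rbt) _.
- apply: cmeasurableD; first exact: cmeasurable_cst.
  by apply/cmeasurableN/cmeasurable_cint => //; exact: xi.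
Qed.

Lemma picard_contraction x y d : admissible r t (2 * A) x ->
  admissible r t (2 * A) y ->
  (forall a, r <= a <= t -> hs_bound s (fun k => x a k - y a k) d) ->
  forall a, r <= a <= t -> hs_bound s (fun k => picard x a k - picard y a k) (d / 2).
Proof.
move=> xadm yadm xyd a rat; have /andP[ra at_] := rat.
have [xA _ _] := xadm; have [yA _ _] := yadm.
have d0 : 0 <= d by exact: hs_bound_ge0 (xyd a rat).
have xi a' b' k : r <= a' -> b' <= t -> _ := cintegrable_bil k xadm.
have yi a' b' k : r <= a' -> b' <= t -> _ := cintegrable_bil k yadm.
have H : hs_bound s (fun k => cint `[r, a] (fun b =>
    bil mu (x b) (x b) k - bil mu (y b) (y b) k))
    (delta * (2 * bil_cst mu s * (2 * A) * d)).
  apply: (hs_bound_duhamel (F := fun b k => bil mu (x b) (x b) k - bil mu (y b) (y b) k))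
    => // [b rbt|k].
    by apply: hs_bound_bil_diff => //; [exact: xA|exact: yA|exact: xyd].
  by apply: cintegrableB; [exact: xi|exact: yi].
apply: hs_bound_le (_ : hs_bound s _ (delta * (2 * bil_cst mu s * (2 * A) * d))) _.
  rewrite (_ : (fun k => _) = fun k => - cint `[r, a] (fun b =>
    bil mu (x b) (x b) k - bil mu (y b) (y b) k)); first exact: hs_boundN.
  apply/funext => k; rewrite -(cintB (xi r a k (lexx r) at_) (yi r a k (lexx r) at_)).
  have alg (p c1 c2 : R[i]) : p - c1 - (p - c2) = - (c1 - c2).
    by rewrite opprB opprB addrCA addrAC subrr add0r.
  exact: alg.
have : (8 * bil_cst mu s * A * delta) * d <= 1 * d by rewrite ler_wpM2r.
lra.
Qed.

Let X n : R -> Z2 -> R[i] := iter n picard (fun _ => phi).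

Lemma picard_iter_admissible n : admissible r t (2 * A) (X n).
Proof.
elim: n => [|n IH]; last exact: picard_admissible.
split=> [a _|a _|k]; [|exact: phi_herm|exact: cmeasurable_cst].
by apply: (hs_bound_le phiA); rewrite mulrDl mul1r lerDl.
Qed.

Lemma picard_iter_step n a : r <= a <= t ->
  hs_bound s (fun k => X n.+1 a k - X n a k) (A * 2^-1 ^+ n).
Proof.
elim: n a => [a rat|n IH a rat]; last first.
  rewrite exprS mulrCA mulrC.
  exact: (picard_contraction (picard_iter_admissible n.+1) (picard_iter_admissible n)).
have /andP[ra at_] := rat; have adm := picard_iter_admissible 0.
rewrite (_ : (fun k => _) = fun k => - cint `[r, a] (fun b => bil mu phi phi k)).
  apply: hs_boundN; apply: (hs_bound_le (hs_bound_duhamel rat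
    (F := fun b k => bil mu phi phi k) (G := bil_cst mu s * A * A) _ _)).
  + by move=> b _; exact: hs_bound_bil_crude.
  + by move=> k; exact: (cintegrable_bil k adm).
  + have : (8 * bil_cst mu s * A * delta) * A <= 1 * A by rewrite ler_wpM2r.
    have : 0 <= bil_cst mu s * A * A * delta by do 3?apply: mulr_ge0 => //.
    have := A_ge0; rewrite expr0; lra.
by apply/funext => k; rewrite /X /= /picard addrAC subrr add0r.
Qed.

Lemma picard_iter_dist n p a : r <= a <= t ->
  hs_bound s (fun k => X (p + n) a k - X n a k) (2 * A * 2^-1 ^+ n).
Proof.
move=> rat.
(* The exact partial geometric sum, needed for the induction on [p] to close. *)
suff H : hs_bound s (fun k => X (p + n) a k - X n a k)
    (2 * A * 2^-1 ^+ n * (1 - 2^-1 ^+ p)).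
  apply: (hs_bound_le H); rewrite ler_piMr ?gerBl ?exprn_ge0 ?invr_ge0 //.
  by rewrite !mulr_ge0 // exprn_ge0 // invr_ge0.
elim: p => [|p IH].
  rewrite expr0 subrr mulr0 (_ : (fun k => _) = fun=> 0); first exact: hs_bound0.
  by apply/funext => k; rewrite subrr.
have := hs_boundD (picard_iter_step (p + n) rat) IH.
rewrite (_ : (fun k => _) = fun k => X (p.+1 + n) a k - X n a k).
  move=> H; apply: (hs_bound_le H); rewrite exprD exprS le_eqVlt; apply/orP; left.
  by apply/eqP; field.
by apply/funext => k; rewrite addrA subrK.
Qed.

Definition picard_limit a k : R[i] :=
  Complex (limn (fun n => cre (X n a k))) (limn (fun n => cim (X n a k))).

Lemma ccvg_picard a k : r <= a <= t -> ccvg (fun n => X n a k) (picard_limit a k).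
Proof.
move=> rat; apply: (@ccvg_half_pow_diff _ A) => n.
exact: (hs_bound_coef k s_ge0 (picard_iter_step n rat)).
Qed.

Lemma picard_limit_admissible : admissible r t (2 * A) picard_limit.
Proof.
split=> [a rat|a rat k|k].
- apply: (hs_bound_lim (u := fun n => X n a)) => [k|n]; first exact: ccvg_picard.
  by have [+ _ _] := picard_iter_admissible n; apply.
- have [c1 c2] := ccvg_picard k rat.
  apply: (ccvg_unique (ccvg_picard (negZ k) rat)).
  have E n : X n a (negZ k) = cconj (X n a k).
    by have [_ + _] := picard_iter_admissible n; apply.
  split; first by under eq_fun do rewrite E /=.
  by under eq_fun do rewrite E /=; exact: cvgN.
- apply: (@cmeasurable_lim _ _ (fun n a => X n a k)) => [n|a /=].
    by have [_ _ +] := picard_iter_admissible n; apply.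
  by rewrite in_itv /=; exact: ccvg_picard.
Qed.

Lemma picard_limit_dist n a : r <= a <= t ->
  hs_bound s (fun k => X n a k - picard_limit a k) (2 * A * 2^-1 ^+ n).
Proof.
move=> rat.
rewrite (_ : (fun k => _) = fun k => - (picard_limit a k - X n a k)); last first.
  by apply/funext => k; rewrite opprB.
apply: hs_boundN.
apply: (hs_bound_lim (u := fun p k => X (p + n) a k - X n a k)) => [k|p].
  apply: ccvgD; last exact: ccvg_cst.
  have [c1 c2] := ccvg_picard k rat.
  by split; [move: c1|move: c2]; rewrite -(cvg_shiftn n).
exact: picard_iter_dist.
Qed.

(** By contraction the Picard images of [X n] converge to the Picard image of the limit; being the
    [X n.+1], they also converge to the limit itself. *)
Lemma local_existence : exists x, mild_solution r t phi x (2 * A).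
Proof.
exists picard_limit; have [xA xh xm] := picard_limit_admissible.
split=> // a rat k.
have [c1 c2] := ccvg_picard k rat.
have c : ccvg (fun n => X n.+1 a k) (picard_limit a k).
  by split; [move: c1|move: c2]; rewrite -(cvg_shiftS).
apply: (ccvg_unique c); apply: (@ccvg_half_pow _ _ (2 * A / 2)) => n.
have := picard_contraction (picard_iter_admissible n) picard_limit_admissible
  (fun a => @picard_limit_dist n a) rat.
move=> /(hs_bound_coef k s_ge0); rewrite [X in _ <= X -> _]mulrAC; exact.
Qed.

End Picard.
End LocalExistence.

(** * A priori bound and continuation *)

Section Continuation.
Set Implicit Arguments.
Unset Strict Implicit.
Local Open Scope classical_set_scope.
Variables (R : realType) (mu s : R).
Hypotheses (mu_gt0 : 0 < mu) (s_gt1 : 1 < s).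
Implicit Types (k : Z2) (th x : R -> Z2 -> R[i]) (phi : Z2 -> R[i]).

(** * Mild solutions: translation, restriction and gluing *)

Lemma hs_bound_in_Hs f (A : R) : hs_bound s f A -> hermitian f -> in_Hs s f.
Proof.
move=> fA fh; split; [by case: fA|exact: fh|].
by apply: le_lt_trans (hs_bound_norm2 fA) _; rewrite ltry.
Qed.

Lemma qg_solution_mild T phi th : qg_solution 2^-1 mu s T phi th ->
  exists A : R, mild_solution mu s 0 T phi th A.
Proof.
move=> [thH [M thM] thm thE]; exists (Num.sqrt M); split => [a aT|a aT|k|a aT k].
- by have [f0 _ _] := thH a aT; apply: norm2_hs_bound => //; exact: thM.
- by have [_ + _] := thH a aT.
- exact: thm.
- by have [_ _] := thE a aT k.
Qed.

Lemma mild_qg_solution T phi th A : mild_solution mu s 0 T phi th A ->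
  qg_solution 2^-1 mu s T phi th.
Proof.
move=> sol; have [thA thh thm thE] := sol; split.
- by move=> t tT; apply: hs_bound_in_Hs (thA t tT) (thh t tT).
- by exists (A ^+ 2) => t tT; exact: hs_bound_norm2 (thA t tT).
- exact: thm.
- move=> t tT k; have /andP[t0 tT'] := tT.
  have [i1 i2] := cintegrable_bil mu_gt0 s_gt1 k (mild_admissible sol) (lexx 0) tT'.
  by split=> //; exact: thE.
Qed.

Lemma mild_restrict T T' phi th A : T' <= T -> mild_solution mu s 0 T phi th A ->
  mild_solution mu s 0 T' phi th A.
Proof.
move=> TT [thA thh thm thE].
have le a : 0 <= a <= T' -> 0 <= a <= T by move=> /andP[-> /le_trans]; apply.
split=> [a /le/thA|a /le/thh|k|a /le/thE] //.
by have [m1 m2] := thm k; split; [apply: measurable_funS m1|apply: measurable_funS m2];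
  rewrite //; exact: sub_itv.
Qed.

Lemma cint_point (a : R) (F : R -> R[i]) : cint `[a, a] F = 0.
Proof. by rewrite /cint set_itv1 !Rintegral_set1. Qed.

Lemma mild_initial T phi th A k : 0 <= T -> mild_solution mu s 0 T phi th A ->
  th 0 k = phi k.
Proof. by move=> T0 [_ _ _ ->]; rewrite ?lexx // cint_point subr0. Qed.

Lemma mild_increment T phi th A a b k : mild_solution mu s 0 T phi th A ->
  0 <= a -> a <= b -> b <= T ->
  th b k = th a k - cint `[a, b] (fun c => bil mu (th c) (th c) k).
Proof.
move=> sol a0 ab bT; have [_ _ _ E] := sol.
rewrite !E ?a0 ?(le_trans a0 ab) ?(le_trans ab bT) //=.
rewrite (cint_split a0 ab); last first.
  exact: (cintegrable_bil mu_gt0 s_gt1 k (mild_admissible sol) (lexx 0) bT).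
by rewrite opprD addrA.
Qed.

Lemma mild_glue (r t : R) phi th x A B : 0 <= r -> r <= t ->
  mild_solution mu s 0 r phi th A -> mild_solution mu s r t (th r) x B ->
  mild_solution mu s 0 t phi (fun a => if a <= r then th a else x a) (Num.max A B).
Proof.
move=> r0 rt solA solB; have [thA thh thm thE] := solA; have [xB xh xm xE] := solB.
set z := fun a => _.
have zl a : a <= r -> z a = th a by rewrite /z => ->.
(* The branches agree at [r], where the integral over a point vanishes, so [z] is described on two
   closed intervals. *)
have zr a : r <= a -> z a = x a.
  rewrite /z => ra; have [ar|//] := leP a r.
  have -> : a = r by apply/le_anti; rewrite ar ra.
  by apply/funext => k; rewrite xE ?lexx // cint_point subr0.
clearbody z.
have zadm : admissible s 0 t (Num.max A B) z.
  split=> [a /andP[a0 at_]|a /andP[a0 at_]|k].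
  - have [ar|/ltW ra] := leP a r.
      by rewrite zl //; apply: (hs_bound_le (thA a _)); rewrite ?a0 // le_max lexx.
    by rewrite zr //; apply: (hs_bound_le (xB a _)); rewrite ?ra // le_max lexx orbT.
  - have [ar|/ltW ra] := leP a r; first by rewrite zl //; apply: thh; rewrite a0.
    by rewrite zr //; apply: xh; rewrite ra.
  - have E : `[0, t] = `[0, r] `|` `[r, t] :> set R.
      apply/seteqP; split=> y /=; rewrite !in_itv /=.
        move=> /andP[-> yt]; have [_|/ltW ry] := leP y r; first by left.
        by right; rewrite ry.
      by move=> [/andP[-> yr]|/andP[ry ->]]; rewrite ?(le_trans yr) // (le_trans r0).
    have [t1 t2] := thm k; have [x1 x2] := xm k.
    have mA := measurable_ccitv 0 r; have mB := measurable_ccitv r t.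
    split; rewrite E; apply/measurable_funU => //; split.
    + by apply: eq_measurable_fun t1 => y /set_mem /=; rewrite in_itv /= => /andP[_ /zl ->].
    + by apply: eq_measurable_fun x1 => y /set_mem /=; rewrite in_itv /= => /andP[/zr -> _].
    + by apply: eq_measurable_fun t2 => y /set_mem /=; rewrite in_itv /= => /andP[_ /zl ->].
    + by apply: eq_measurable_fun x2 => y /set_mem /=; rewrite in_itv /= => /andP[/zr -> _].
have [z1 z2 z3] := zadm; split=> // a /andP[a0 at_] k.
have zi := cintegrable_bil mu_gt0 s_gt1 k zadm (lexx 0) at_.
have El b : b <= r -> cint `[0, b] (fun c => bil mu (z c) (z c) k) =
    cint `[0, b] (fun c => bil mu (th c) (th c) k).
  move=> br; apply: cint_ext => y /=; rewrite in_itv /= => /andP[_ yb].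
  by rewrite zl // (le_trans yb).
have Er : cint `[r, a] (fun c => bil mu (z c) (z c) k) =
    cint `[r, a] (fun c => bil mu (x c) (x c) k).
  by apply: cint_ext => y /=; rewrite in_itv /= => /andP[ry _]; rewrite zr.
have [ar|/ltW ra] := leP a r.
  have aT : 0 <= a <= r by rewrite a0.
  rewrite (El a ar) (zl a ar); exact: (thE a aT k).
have rat : r <= a <= t by rewrite ra.
have rT : 0 <= r <= r by rewrite r0 lexx.
rewrite (cint_split r0 ra zi) Er (El r (lexx r)) (zr a ra) (xE a rat k) (thE r rT k).
by rewrite opprD addrA.
Qed.

(** * Discrete Gronwall inequality *)

Lemma half_pow_small (A e : R) : 0 < e -> exists n, A * 2^-1 ^+ n <= e.
Proof.
move=> e0; have /cvgr0Pnorm_le /(_ e e0) [N _ /(_ N (leqnn N)) /= H] := cvg_half_pow A.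
by exists N; apply: le_trans H; exact: ler_norm.
Qed.

(* The linear Gronwall step: [y] and any bound [Y] give the bound [y + Y / 2]. *)
Lemma mild_doubling T phi th (A L a h y : R) : mild_solution mu s 0 T phi th A ->
  (forall b, 0 <= b <= T -> l1_bound (th b) L) -> 0 <= L ->
  4 * tame_cst mu s * L * h <= 1 -> 0 <= a -> hs_bound s (th a) y ->
  forall b, a <= b -> b <= a + h -> b <= T -> hs_bound s (th b) (2 * y).
Proof.
move=> sol thL L0 hL a0 thy.
have [thA _ _ _] := sol.
have y0 := hs_bound_ge0 thy.
have C0 : 0 < tame_cst mu s by exact: tame_cst_gt0.
(* Iterating [Y |-> y + Y / 2] from the crude bound [2 * y + A] halves the excess over the fixed
   point [2 * y]. The 4 in the condition on [h] makes the increment, at rate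
   [2 * tame_cst mu s * L * Y], at most [Y / 2]. *)
have H n b : a <= b -> b <= a + h -> b <= T ->
    hs_bound s (th b) (2 * y + A * 2^-1 ^+ n).
  elim: n b => [|n IH] b ab bh bT.
    apply: (hs_bound_le (thA b _)); first by rewrite (le_trans a0) // bT.
    by rewrite expr0 mulr1 lerDr mulr_ge0.
  rewrite (_ : th b = fun k => th a k - cint `[a, b] (fun c => bil mu (th c) (th c) k));
    last by apply/funext => k; exact: mild_increment sol a0 ab bT.
  set Y := 2 * y + A * 2^-1 ^+ n in IH.
  have Y0 : 0 <= Y.
    by apply: (hs_bound_ge0 (IH a (lexx a) _ _)); rewrite ?(le_trans ab).
  have G : hs_bound s (fun k => cint `[a, b] (fun c => bil mu (th c) (th c) k))
      ((b - a) * (tame_cst mu s * (L * Y + L * Y))).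
    apply: (hs_bound_cint (F := fun c k => bil mu (th c) (th c) k) ab) => [c|k].
      move=> /andP[ac cb]; have cT := le_trans cb bT.
      have c0T : 0 <= c <= T by rewrite (le_trans a0).
      have cY : hs_bound s (th c) Y by apply: IH; rewrite // (le_trans cb).
      exact: (hs_bound_bil mu_gt0 s_gt1 cY cY (thL c c0T) (thL c c0T)).
    exact: (cintegrable_bil mu_gt0 s_gt1 k (mild_admissible sol) a0 bT).
  apply: (hs_bound_le (hs_boundB thy G)).
  have h1 : (b - a) * (2 * tame_cst mu s * L * Y) <= h * (2 * tame_cst mu s * L * Y).
    rewrite ler_wpM2r ?lerBlDl // mulr_ge0 // mulr_ge0 // mulr_ge0 // ltW //.
  have h2 : (4 * tame_cst mu s * L * h) * Y <= 1 * Y by rewrite ler_wpM2r.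
  have h3 : Y = 2 * y + A * 2^-1 ^+ n by [].
  rewrite exprS; lra.
move=> b ab bh bT; apply: hs_bound_eps => e e0.
have [n An] := half_pow_small A e0.
by apply: (hs_bound_le (H n b ab bh bT)); rewrite lerD2l.
Qed.

(** Each step of length [h] costs a factor 2; with [n] about [T / h], the power [2 ^+ n] replaces
    the exponential in Gronwall's inequality. *)
Lemma mild_doublings T phi th (A L h y : R) : mild_solution mu s 0 T phi th A ->
  (forall b, 0 <= b <= T -> l1_bound (th b) L) -> 0 <= L -> 0 <= h ->
  4 * tame_cst mu s * L * h <= 1 -> hs_bound s phi y ->
  forall n b, 0 <= b <= T -> b <= n%:R * h -> hs_bound s (th b) (2 ^+ n * y).
Proof.
move=> sol thL L0 h0 hL phiy; have y0 := hs_bound_ge0 phiy.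
elim=> [|n IH] b bT bn.
  have b0 : b = 0.
    by apply/le_anti; move: bn bT; rewrite mul0r => -> /andP[-> _].
  rewrite expr0 mul1r b0 (_ : th 0 = phi) //; apply/funext => k.
  by apply: mild_initial sol; move: bT; rewrite b0 => /andP[].
have /andP[b0 bT'] := bT.
have [bnh|/ltW nhb] := leP b (n%:R * h).
  apply: (hs_bound_le (IH b bT bnh)); rewrite exprS -mulrA ler_peMl ?ler1n //.
  by rewrite mulr_ge0 // exprn_ge0.
rewrite exprS -mulrA.
apply: (mild_doubling sol thL L0 hL _ (IH (n%:R * h) _ (lexx _)) nhb) => //.
- by rewrite mulr_ge0.
- by rewrite mulr_ge0 //= (le_trans nhb).
- by move: bn; rewrite -addn1 natrD mulrDl mul1r.
Qed.

(** * A priori bound in H^s *)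

Lemma expr_unbounded (q x : R) : 1 < q -> exists n, x <= q ^+ n.
Proof.
move=> q1.
have bern n : 1 + n%:R * (q - 1) <= q ^+ n.
  elim: n => [|n IH]; first by rewrite mul0r addr0 expr0.
  rewrite exprS -natr1; have n0 : 0 <= n%:R :> R by [].
  have : q * (1 + n%:R * (q - 1)) <= q * q ^+ n by rewrite ler_pM2l // (lt_trans ltr01).
  have : 0 <= n%:R * (q - 1) ^+ 2 by rewrite mulr_ge0 ?sqr_ge0.
  lra.
have x0 : 0 <= `|x| / (q - 1) by rewrite divr_ge0 // subr_ge0 ltW.
exists (Num.bound (`|x| / (q - 1))); apply: le_trans (bern _).
have := archi_boundP x0; rewrite ltr_pdivrMr ?subr_gt0 // => /ltW.
by have := ler_norm x; lra.
Qed.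

(* A bound [q^(m+1)] on the [H^s] norm puts only [sqrt m] in the Gronwall rate, hence
   improves itself to [q^m] as soon as [m] is large: the a priori bound follows by
   descending on [m]. *)
Lemma a_priori_bound (T1 M y : R) phi : 0 <= T1 -> hs_bound s phi y -> exists B : R,
  forall T th A, T <= T1 -> mild_solution mu s 0 T phi th A ->
  (forall b, 0 <= b <= T -> hs_bound 1 (th b) M) ->
  forall b, 0 <= b <= T -> hs_bound s (th b) B.
Proof.
move=> T10 phiy; have y0 := hs_bound_ge0 phiy.
(* A negative [M] bounds no norm, so that case is vacuous. *)
have [M0|Mlt0] := leP 0 M; last first.
  exists 0 => T th A _ _ thM b /thM /hs_bound_ge0 /(lt_le_trans Mlt0).
  by rewrite ltxx.
pose p : R := 2 `^ (1 - s); pose q := p^-1.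
have p0 : 0 < p by rewrite powR_gt0.
have q1 : 1 < q by rewrite invf_gt1 // powR2_lt1.
have q0 : 0 < q by rewrite (lt_trans ltr01).
pose c := l1_cst s; have c0 : 0 < c by exact: l1_cst_gt0.
pose C := tame_cst mu s; have C0 : 0 < C by exact: tame_cst_gt0.
(* The l^1 bound under the H^s bound [q ^+ m]: the high-frequency factor [p ^+ m] cancels it,
   leaving the constant [c]. *)
pose L m : R := 4 * Num.sqrt m%:R * M + c.
have L0 m : 0 < L m by rewrite ltr_wpDl // !mulr_ge0 // sqrtr_ge0.
pose h m := (4 * C * L m)^-1.
have CL0 m : 0 < 4 * C * L m by rewrite mulr_gt0 // mulr_gt0.
have h0 m : 0 < h m by rewrite invr_gt0.
(* Number of steps of length [h m] covering [[0, T1]]; the successor compensates the truncation. *)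
pose J m := (Num.truncn (T1 * (4 * C * L m))).+1.
have J0 m : 0 <= T1 * (4 * C * L m) by rewrite mulr_ge0 // ltW.
have TJ m : T1 <= (J m)%:R * h m.
  rewrite ler_pdivlMr //; have /andP[_ /ltW] := truncn_itv (J0 m); exact.
have JT m : (J m)%:R <= T1 * (4 * C * L m) + 1.
  by rewrite /J -natr1 lerD2r; have /andP[] := truncn_itv (J0 m).
have step T th A m : T <= T1 -> mild_solution mu s 0 T phi th A ->
    (forall b, 0 <= b <= T -> hs_bound 1 (th b) M) ->
    (forall b, 0 <= b <= T -> hs_bound s (th b) (q ^+ m)) ->
    forall b, 0 <= b <= T -> hs_bound s (th b) (2 ^+ J m * y).
  move=> TT1 sol thM thq b bT.
  apply: (mild_doublings sol (L := L m) (h := h m) _ _ _ _ phiy) => //.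
  - move=> d dT; have := hs_bound_l1_log m s_gt1 (thM d dT) (thq d dT).
    have E : p ^+ m * q ^+ m = 1 by rewrite -exprMn divff ?gt_eqF // expr1n.
    by rewrite -/p -(mulrA (l1_cst s)) E mulr1.
  - exact: ltW.
  - exact: ltW.
  - by rewrite -/C divff // gt_eqF.
  - by move: bT => /andP[_ bT]; rewrite (le_trans bT) // (le_trans TT1).
(* Writing [y <= 2 ^+ e] and [2 <= q ^+ j] reduces the improvement to comparing exponents of [q]. *)
have [e ye] : exists e, y <= 2 ^+ e by apply: expr_unbounded; rewrite ltr1n.
have [j qj] := expr_unbounded 2 q1.
(* The exponent [j * (J m.+1 + e)] is at most [a' + b' * x] with [x] the square root of [m + 1]. *)
pose a' := j%:R * (T1 * (4 * C * c) + 1 + e%:R).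
pose b' := j%:R * (T1 * (16 * C * M)).
have a'0 : 0 <= a'.
  apply: mulr_ge0 => //; apply: addr_ge0 => //; apply: addr_ge0 => //.
  by apply: mulr_ge0 => //; apply: mulr_ge0; [apply: mulr_ge0 => //|]; exact: ltW.
have b'0 : 0 <= b'.
  apply: mulr_ge0 => //; apply: mulr_ge0 => //; apply: mulr_ge0 => //.
  by apply: mulr_ge0 => //; exact: ltW.
(* Beyond [m0] one has [x >= a' + b' + 1], which gives [a' + b' * x <= x ^+ 2 - 1 = m]. *)
pose m0 := Num.bound ((a' + b' + 1) ^+ 2).
have improve m : (m0 <= m)%N -> 2 ^+ J m.+1 * y <= q ^+ m.
  move=> m0m; apply: (@le_trans _ _ (2 ^+ (J m.+1 + e))).
    by rewrite exprD ler_wpM2l // exprn_ge0.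
  apply: (@le_trans _ _ (q ^+ (j * (J m.+1 + e)))).
    rewrite exprM; apply: lerXn2r => //; rewrite nnegrE // exprn_ge0 // ltW //.
  apply: ler_weXn2l; first exact: ltW.
  rewrite -(ler_nat R) natrM natrD.
  pose x : R := Num.sqrt m.+1%:R.
  have x0 : 0 <= x by exact: sqrtr_ge0.
  have x2 : x ^+ 2 = m%:R + 1 by rewrite sqr_sqrtr // natr1.
  have xbig : a' + b' + 1 <= x.
    rewrite -ler_sqr ?nnegrE ?addr_ge0 // x2.
    have := archi_boundP (sqr_ge0 (a' + b' + 1)); rewrite -/m0 => /ltW H.
    by apply: (le_trans H); rewrite natr1 ler_nat leqW.
  have : j%:R * ((J m.+1)%:R + e%:R) <= a' + b' * x.
    rewrite (_ : a' + b' * x = j%:R * (T1 * (4 * C * L m.+1) + 1 + e%:R)).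
      by rewrite ler_wpM2l // lerD2r JT.
    by rewrite /a' /b' /L -/x; ring.
  move=> H; apply: (le_trans H).
  have : (b' + 1) * x <= x * x by rewrite ler_wpM2r //; lra.
  by rewrite -expr2 x2; lra.
exists (q ^+ m0) => T th A TT1 sol thM.
(* Only the starting level [n] depends on the solution; the final level [m0] does not. *)
have [n An] := expr_unbounded A q1.
have descend i : (forall b, 0 <= b <= T -> hs_bound s (th b) (q ^+ (m0 + i))) ->
    forall b, 0 <= b <= T -> hs_bound s (th b) (q ^+ m0).
  elim: i => [|i IH]; first by rewrite addn0.
  rewrite addnS => H; apply: IH => b bT.
  apply: (hs_bound_le (step T th A _ TT1 sol thM H b bT)).
  by rewrite improve // leq_addr.
apply: (descend n) => b bT; have [thA _ _ _] := sol.
apply: (hs_bound_le (thA b bT)); apply: (le_trans An).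
by apply: ler_weXn2l; [exact: ltW|exact: leq_addl].
Qed.

(** The a priori bound is common to all extensions, so they grow by a fixed length [d], and finitely
    many of them reach [T1]. *)
Lemma mild_extend T T1 phi th A M : 0 <= T ->
  mild_solution mu s 0 T phi th A ->
  (forall T' th' A', T' < T1 -> mild_solution mu s 0 T' phi th' A' ->
    forall b, 0 <= b <= T' -> hs_bound 1 (th' b) M) ->
  exists th2 B, mild_solution mu s 0 T1 phi th2 B /\
    forall t, t <= T -> th2 t = th t.
Proof.
move=> T0 sol H1.
have [T1T|/ltW TT1] := leP T1 T.
  by exists th, A; split => //; exact: mild_restrict sol.
have T10 := le_trans T0 TT1.
have phiA : hs_bound s phi A.
  have [thA _ _ _] := sol; rewrite (_ : phi = th 0); first by apply: thA; rewrite lexx.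
  by apply/funext => k; rewrite (mild_initial k T0 sol).
have [B HB] := a_priori_bound M T10 phiA.
(* A strictly positive bound, so that [d] below is positive. *)
pose B1 := `|B| + 1; have B10 : 0 < B1 by rewrite ltr_wpDl.
have K0 : 0 < bil_cst mu s by exact: bil_cst_gt0.
pose d := (8 * bil_cst mu s * B1)^-1.
have d0 : 0 < d by rewrite invr_gt0 mulr_gt0 // mulr_gt0.
(* The extension stops once [T1] is reached, since the H^1 hypothesis covers only [T' < T1]; an
   overshoot is restricted away afterwards. *)
have iter_ext n : exists T' th' A', [/\ T <= T', T1 <= T' \/ T + n%:R * d <= T',
    mild_solution mu s 0 T' phi th' A' & forall t, t <= T -> th' t = th t].
  elim: n => [|n [T' [th' [A' [TT' or_ sol' E]]]]].
    by exists T, th, A; split=> //; right; rewrite mul0r addr0.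
  have [T1T'|T'T1] := leP T1 T'.
    by exists T', th', A'; split=> //; left.
  have {}or_ : T + n%:R * d <= T'.
    by case: or_ => //; rewrite leNgt T'T1.
  have T'0 := le_trans T0 TT'.
  have T'T' : 0 <= T' <= T' by rewrite T'0 lexx.
  have bB : hs_bound s (th' T') B1.
    apply: (hs_bound_le (HB T' th' A' (ltW T'T1) sol' (H1 T' th' A' T'T1 sol') T' T'T')).
    by rewrite (le_trans (ler_norm B)) // lerDl.
  have hT' : hermitian (th' T') by have [_ + _ _] := sol'; apply.
  have small : 8 * bil_cst mu s * B1 * d <= 1.
    by rewrite divff // gt_eqF // mulr_gt0 // mulr_gt0.
  have [x solx] := local_existence mu_gt0 s_gt1 T' (ltW d0) bB hT' small.
  have T'd : T' <= T' + d by rewrite lerDl ltW.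
  have := mild_glue T'0 T'd sol' solx; set z := fun a => _ => solz.
  exists (T' + d), z, (Num.max A' (2 * B1)); split=> //.
  - by rewrite (le_trans TT').
  - by right; rewrite -natr1 mulrDl mul1r addrA lerD2r.
  - by move=> t tT; rewrite /z (le_trans tT TT') E.
have nd0 : 0 <= (T1 - T) / d by rewrite divr_ge0 ?subr_ge0 // ltW.
have [T' [th' [A' [TT' or_ sol' E]]]] := iter_ext (Num.bound ((T1 - T) / d)).
have T1T' : T1 <= T'.
  case: or_ => //; apply: le_trans.
  have := archi_boundP nd0; rewrite ltr_pdivrMr // => /ltW; lra.
by exists th', A'; split => //; exact: mild_restrict sol'.
Qed.

End Continuation.

Theorem theorem3p5 (R : realType) (mu s T T1 : R)
  (th0 : Z2 -> R[i]) (th : R -> Z2 -> R[i]) :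
  0 < mu -> 1 < s -> 0 < T -> T < T1 ->
  in_Hs s th0 ->
  qg_solution (2^-1) mu s T th0 th ->
  (exists M : R, forall (T' : R) (th' : R -> Z2 -> R[i]),
      T' < T1 -> qg_solution (2^-1) mu s T' th0 th' ->
      forall t : R, 0 <= t <= T' -> (Hs_norm2 1 (th' t) <= M%:E)%E) ->
  exists th2 : R -> Z2 -> R[i],
    qg_solution (2^-1) mu s T1 th0 th2 /\
    (forall t : R, 0 <= t <= T -> th2 t = th t).
Proof.
move=> mu0 s1 T0 TT1 _ sol [M HM].
have [A msol] := qg_solution_mild sol.
(* [Hs_norm2] is a squared norm, hence the square root of [M]. *)
have [|th2 [B [sol2 E]]] := mild_extend (T1 := T1) (M := Num.sqrt M) mu0 s1 (ltW T0) msol.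
  move=> T' th' A' T'T1 sol' b bT'.
  have [/(_ b bT')[th'0 _] _ _ _] := sol'.
  apply: norm2_hs_bound => //.
  exact: HM T'T1 (mild_qg_solution mu0 s1 sol') b bT'.
exists th2; split; first exact: (mild_qg_solution mu0 s1 sol2).
by move=> t /andP[_ tT]; exact: E.
Qed.
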